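(* Suppose $R_i = 2^{i-1}\sqrt{3\rho}$ for $1\le i\le p$ and the stepsize satisfies $\alpha \le \frac{1}{10R_p^2}$. Then there is a set $W\subset\mathbb{R}^{n\times p}$ of measure zero such that for every initial point $X^{(0)} = (x_1^{(0)},\dots,x_p^{(0)})\in\mathbb{R}^{n\times p}$ satisfying $\|x_i^{(0)}\|\le R_i$ for all $1\le i\le p$ and $X^{(0)}\notin W$, the iteration $X^{(t+1)} = X^{(t)}-\alpha\, g(X^{(t)})$ converges to $\mathcal{X}^*$, that is, $\lim_{t\to\infty}\|X^{(t)}-\mathcal{X}^*\|_F = 0$.
   Context: Let $A\in\mathbb{R}^{n\times n}$ be symmetric, let $\lambda_i$ be its $i$-th smallest eigenvalue ($\lambda_1\le\dots\le\lambda_n$), and let $u_1,\dots,u_n$ be a corresponding orthonormal basis of eigenvectors. Let $q$ be the number of negative eigenvalues of $A$ and let $p\le q$ be the number of desired eigenpairs. Let $\rho=\|A\|_2$; $\|\cdot\|$ is the Euclidean norm of vectors and $\|\cdot\|_F$ the Frobenius norm. Let $U_p=(u_1,\dots,u_p)$ and $\Lambda_p=\mathrm{diag}(\lambda_1,\dots,\lambda_p)$. Define $g(X)=AX+X\,\mathrm{triu}(X^\top X)$ for $X\in\mathbb{R}^{n\times p}$, where $\mathrm{triu}(\cdot)$ is the upper triangular part of a matrix including the diagonal. With a constant stepsize $\alpha>0$, the iteration is $X^{(t+1)}=X^{(t)}-\alpha g(X^{(t)})$, $t=0,1,2,\dots$; columnwise, $x_i^{(t+1)}=x_i^{(t)}-\alpha\big(Ax_i^{(t)}+\sum_{j=1}^i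 x_j^{(t)}(x_j^{(t)})^\top x_i^{(t)}\big)$, where $x_i^{(t)}$ is the $i$-th column of $X^{(t)}$. Let $\mathcal{X}^*=\{U_p\sqrt{-\Lambda_p}\,D : D\in\mathbb{R}^{p\times p}\text{ diagonal with diagonal entries }\pm1\}$ (square root taken entrywise), and $\|X-\mathcal{X}^*\|_F=\min_{Y\in\mathcal{X}^*}\|X-Y\|_F$.
   Formalization: X* is taken as the union of the sets U_p√(-Λ_p)D over all ordered orthonormal eigenbases, since for one fixed basis the claim fails with repeated eigenvalues (A = -I_2, p = 1); if λ_1 < … < λ_p < λ_{p+1}, it is the original X*. *)

(* Defs.v *)
From HB Require Import structures.
From mathcomp Require Import all_boot all_order all_algebra.
From mathcomp Require Import all_classical all_reals all_analysis.
Import Order.TTheory GRing.Theory Num.Theory numFieldNormedType.Exports.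

Set Implicit Arguments.
Unset Strict Implicit.
Unset Printing Implicit Defensive.

Local Open Scope classical_set_scope.
Local Open Scope ring_scope.

(* The library's [`| _ |] on matrices is the max norm, so the Euclidean,
   Frobenius and spectral norms are defined here. *)
Definition enorm (R : realType) n (x : 'cV[R]_n) : R :=
  Num.sqrt (\sum_i x i 0 ^+ 2).

Definition normF (R : realType) m n (X : 'M[R]_(m, n)) : R :=
  Num.sqrt (\sum_i \sum_j X i j ^+ 2).

Definition spectral_norm (R : realType) n (A : 'M[R]_n) : R :=
  sup [set enorm (A *m x) | x in [set x : 'cV[R]_n | enorm x <= 1]].

Definition distF (R : realType) m n (X : 'M[R]_(m, n)) (S : set 'M[R]_(m, n))
  : R := inf [set normF (X - Y) | Y in S].

Definition box (R : realType) m n (a b : 'M[R]_(m, n)) : set 'M[R]_(m, n) :=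
  [set X | forall i j, a i j <= X i j <= b i j].

Definition box_volume (R : realType) m n (a b : 'M[R]_(m, n)) : R :=
  \prod_i \prod_j (b i j - a i j).

(* Measure zero for Lebesgue measure on the (m * n)-dimensional space of
   matrices: countable covers by boxes of arbitrarily small total volume. *)
Definition measure_zero (R : realType) m n (W : set 'M[R]_(m, n)) : Prop :=
  forall e : R, 0 < e ->
    exists a b : nat -> 'M[R]_(m, n),
      [/\ forall k i j, a k i j <= b k i j,
          W `<=` \bigcup_k box (a k) (b k)
        & (\sum_(0 <= k <oo) (box_volume (a k) (b k))%:E <= e%:E)%E].

(* [lam] lists the eigenvalues of [A] in nondecreasing order, with
   multiplicity; the columns of [U] are corresponding orthonormal
   eigenvectors. *)
Definition ordered_eigenbasis (R : realType) n (A : 'M[R]_n)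
    (lam : 'I_n -> R) (U : 'M[R]_n) : Prop :=
  [/\ forall i j : 'I_n, (i <= j)%N -> lam i <= lam j,
      U^T *m U = 1%:M
    & forall i, A *m col i U = lam i *: col i U].

Definition num_neg (R : realType) n (lam : 'I_n -> R) : nat :=
  #|[set i | lam i < 0]%SET|.

Lemma num_neg_bound (R : realType) n p (lam : 'I_n -> R) :
  (p <= num_neg lam)%N -> (p <= n)%N.
Proof. by move=> h; apply: leq_trans h _; rewrite -[leqRHS]card_ord max_card. Qed.

Definition triu (R : realType) p (M : 'M[R]_p) : 'M[R]_p :=
  \matrix_(i, j) (if (i <= j)%N then M i j else 0).

Definition g (R : realType) n p (A : 'M[R]_n) (X : 'M[R]_(n, p))
  : 'M[R]_(n, p) := A *m X + X *m triu (X^T *m X).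

Definition iterate (R : realType) n p (A : 'M[R]_n) (alpha : R)
    (X0 : 'M[R]_(n, p)) (t : nat) : 'M[R]_(n, p) :=
  iter t (fun X => X - alpha *: g A X) X0.

(* [i] is 1-based here. *)
Definition col_radius (R : realType) (rho : R) (i : nat) : R :=
  2 ^+ i.-1 * Num.sqrt (3 * rho).

Definition first_cols (R : realType) n p (hpn : (p <= n)%N) (U : 'M[R]_n)
  : 'M[R]_(n, p) := colsub (widen_ord hpn) U.

Definition first_eigs (R : realType) n p (hpn : (p <= n)%N) (lam : 'I_n -> R)
  : 'M[R]_p := diag_mx (\row_j lam (widen_ord hpn j)).

Definition sign_diag (R : realType) p (D : 'M[R]_p) : Prop :=
  is_diag_mx D /\ forall j, D j j = 1 \/ D j j = -1.

Definition Xstar_of (R : realType) n p (hpn : (p <= n)%N) (lam : 'I_n -> R)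
    (U : 'M[R]_n) : set 'M[R]_(n, p) :=
  [set Y | exists2 D, sign_diag D &
     Y = first_cols hpn U *m map_mx Num.sqrt (- first_eigs hpn lam) *m D].

(* If some of the p smallest eigenvalues is repeated, U_p is not determined up
   to signs, and the limit of the iteration is built from an eigenbasis that
   depends on the initial point (for A = -I and p = 1 the direction of the
   iterates never changes).  Hence U_p ranges over all admissible eigenbases;
   [Xstar_simple] shows that this is immaterial for simple eigenvalues. *)
Definition Xstar (R : realType) n p (hpn : (p <= n)%N) (A : 'M[R]_n)
    (lam : 'I_n -> R) : set 'M[R]_(n, p) :=
  \bigcup_(U in ordered_eigenbasis A lam) Xstar_of hpn lam U.

Lemma Xstar_simple (R : realType) n p (hpn : (p <= n)%N) (A : 'M[R]_n)
    (lam : 'I_n -> R) (U : 'M[R]_n) :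
  A^T = A -> ordered_eigenbasis A lam U ->
  (forall i j : 'I_n, (i < p)%N -> (i < j)%N -> lam i < lam j) ->
  Xstar hpn A lam = Xstar_of hpn lam U.
Proof.
move=> symA hU sep; apply/seteqP; split=> [Y [V hV [D [dD sD] ->]]|Y hY]; last first.
  by exists U.
have eigE W : ordered_eigenbasis A lam W ->
    A *m W = W *m diag_mx (\row_j lam j).
  move=> [_ _ hW]; apply/matrixP=> i j; rewrite mul_mx_diag !mxE.
  have /matrixP/(_ i 0) := hW j; rewrite !mxE mulrC => <-.
  by apply: eq_bigr => k _; rewrite !mxE.
have [_ oU _] := hU; have [_ oV _] := hV.
pose M := U^T *m V.
have VE : V = U *m M by rewrite mulmxA (mulmx1C oU) mul1mx.
have MM : M^T *m M = 1%:M.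
  by rewrite /M trmx_mul trmxK mulmxA -(mulmxA _ U) (mulmx1C oU) mulmx1.
have com k j : lam k * M k j = M k j * lam j.
  have E : diag_mx (\row_j lam j) *m M = M *m diag_mx (\row_j lam j).
    rewrite /M -[RHS]mulmxA -(eigE _ hV) !mulmxA; congr (_ *m _).
    by rewrite -[LHS]trmxK trmx_mul trmxK tr_diag_mx -(eigE _ hU) trmx_mul symA.
  by move/matrixP/(_ k j): E; rewrite mul_mx_diag mul_diag_mx !mxE.
clearbody M.
have M0 (k j : 'I_n) : (j < p)%N -> k != j -> M k j = 0.
  move=> jp kj; apply/eqP; have /eqP := com k j.
  rewrite mulrC -subr_eq0 -mulrBr mulf_eq0 subr_eq0 => /orP[//|/eqP lkj].
  have [lt|lt|/val_inj e] := ltngtP k j; last by rewrite e eqxx in kj.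
  - by have := sep k j (ltn_trans lt jp) lt; rewrite lkj ltxx.
  - by have := sep j k jp lt; rewrite lkj ltxx.
pose w := widen_ord hpn.
pose C : 'M[R]_p := diag_mx (\row_j M (w j) (w j)).
have M1 (j : 'I_p) : M (w j) (w j) = 1 \/ M (w j) (w j) = -1.
  have /matrixP/(_ (w j) (w j)) := MM; rewrite !mxE eqxx (bigD1 (w j)) //= big1.
    rewrite addr0 [M^T _ _]mxE -expr2 => /eqP; rewrite sqrf_eq1.
    by case/orP => /eqP h; auto.
  by move=> k kj; rewrite (M0 k) ?mulr0 //= ltn_ord.
have VpE : first_cols hpn V = first_cols hpn U *m C.
  apply/matrixP=> i j; rewrite mul_mx_diag !mxE {1}VE mxE (bigD1 (w j)) //= big1 ?addr0 //.
  by move=> k kj; rewrite (M0 k) ?mulr0 //= ltn_ord.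
have [d DE] := diag_mxP _ dD.
exists (C *m D).
  split; first by rewrite /C DE mulmx_diag diag_mx_is_diag.
  move=> j; rewrite /C mul_diag_mx !mxE.
  by case: (M1 j) (sD j) => -> [] ->; rewrite ?mulr1 ?mul1r ?mulrN1 ?opprK; auto.
rewrite VpE !mulmxA; congr (_ *m _); rewrite -!mulmxA; congr (_ *m _).
apply/matrixP=> i j; rewrite mul_diag_mx mul_mx_diag !mxE.
have [->|ij] := eqVneq i j; first by rewrite mulrC.
by rewrite mulr0n oppr0 sqrtr0 mulr0 mul0r.
Qed.

(* Main.v *)
(* Column i only sees columns j < i:
     x_i' = (1 - alpha |x_i|^2) x_i - alpha B x_i,  B = A + sum_(j < i) x_j x_j^T,
   so one inducts on i.  If the previous columns converge (exponentially) to
   scaled eigenvectors, B converges to a matrix whose lowest eigenvalue is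
   lam_i, with eigenprojection P and Q = 1 - P.  Either |P x_i| > eta |Q x_i| at
   some late time; then |Q x_i| / |P x_i| decays exponentially, |x_i| tends to
   sqrt (- lam_i), and x_i converges exponentially to a scaled eigenvector.  Or
   |P x_i| <= eta |Q x_i| at all late times.  Two such trajectories x, y with the
   same previous columns and with x - y in the cone |Q d| <= kc |P d| stay in
   that cone, while |P (x - y)|^2 / (|Q x| |Q y|) grows geometrically, although
   it is bounded.  Hence the late-time exceptional set is a graph over all matrix
   entries but one, so it is null.  It is pulled back to time 0 by the iteration
   map, which has a Lipschitz inverse on the invariant box |x_i| <= R_i because
   alpha is small.  When eigenvalues are repeated, P depends on the limit of the
   previous columns, and countably many eigenbases are used to approximate it. *)
Require Import Defs.
From HB Require Import structures.
From mathcomp Require Import all_boot all_order all_algebra.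
From mathcomp Require Import all_classical all_reals all_analysis.
From mathcomp Require Import ring lra.
Import Order.TTheory GRing.Theory Num.Theory numFieldNormedType.Exports.

Set Implicit Arguments.
Unset Strict Implicit.
Unset Printing Implicit Defensive.

Local Open Scope classical_set_scope.
Local Open Scope ring_scope.

(** * Euclidean geometry of columns *)

(** A stable manifold theorem does not apply directly: the map seen by column i varies in time with
    its predecessors, and repeated eigenvalues turn its limits into continua. Comparing two
    trajectories requires no fixed point. With d = x - y, w = x + y and s = (|x|^2 + |y|^2) / 2, the
    cubic terms satisfy |x|^2 x - |y|^2 y = s d + (w . d) w / 2. The rank-one term is positive
    semidefinite, so on the Q side it can only shrink d, and its P part is small because x and y
    both lie close to the range of Q. Hence |P d| is multiplied by about 1 - al (lam + s), and |Q x|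
    |Q y| by at most about (1 - al (lam + gam + s))^2. Alone, |P d| may shrink while s exceeds -lam;
    in the quotient |P d|^2 / (|Q x| |Q y|) the unknown s no longer matters and the spectral gap gam
    forces growth. The quotient also copes with trajectories that approach 0, where |Q x| has no
    positive lower bound. *)

Definition dotv (R : realType) n (x y : 'cV[R]_n) : R := \sum_k x k 0 * y k 0.

Definition mask (R : realType) n (K : pred 'I_n) (x : 'cV[R]_n) : 'cV[R]_n :=
  \col_k (if K k then x k 0 else 0).

Definition dscale (R : realType) n (D : 'I_n -> R) (x : 'cV[R]_n) : 'cV[R]_n :=
  \col_k (D k * x k 0).

Section Vectors.
Context {R : realType} {n : nat}.
Implicit Types (x y z : 'cV[R]_n) (K : pred 'I_n) (a b : R).

Lemma dotvC x y : dotv x y = dotv y x.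
Proof. by apply: eq_bigr => k _; rewrite mulrC. Qed.

Lemma dotvDl x y z : dotv (x + y) z = dotv x z + dotv y z.
Proof. by rewrite -big_split; apply: eq_bigr => k _; rewrite mxE mulrDl. Qed.

Lemma dotvZl a x y : dotv (a *: x) y = a * dotv x y.
Proof. by rewrite mulr_sumr; apply: eq_bigr => k _; rewrite mxE mulrA. Qed.

Lemma dotvNl x y : dotv (- x) y = - dotv x y.
Proof. by rewrite -scaleN1r dotvZl mulN1r. Qed.

Lemma dotvDr x y z : dotv z (x + y) = dotv z x + dotv z y.
Proof. by rewrite dotvC dotvDl !(dotvC z). Qed.

Lemma dotvZr a x y : dotv y (a *: x) = a * dotv y x.
Proof. by rewrite dotvC dotvZl (dotvC y). Qed.

Lemma dotvNr x y : dotv y (- x) = - dotv y x.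
Proof. by rewrite dotvC dotvNl (dotvC y). Qed.

Lemma dotv0r x : dotv x 0 = 0.
Proof. by rewrite /dotv big1 // => k _; rewrite mxE mulr0. Qed.

Lemma dotv_sumr (I : Type) (s : seq I) (P : pred I) (F : I -> 'cV[R]_n) x :
  dotv x (\sum_(i <- s | P i) F i) = \sum_(i <- s | P i) dotv x (F i).
Proof.
elim/big_rec2: _ => [|i u v _ <-]; first exact: dotv0r.
by rewrite dotvDr.
Qed.

Definition dotvE := (dotvDl, dotvDr, dotvZl, dotvZr, dotvNl, dotvNr).

Lemma dotv_ge0 x : 0 <= dotv x x.
Proof. by apply: sumr_ge0 => k _; rewrite -expr2 sqr_ge0. Qed.

Lemma enorm_ge0 x : 0 <= enorm x.
Proof. exact: sqrtr_ge0. Qed.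

Lemma enormE x : enorm x ^+ 2 = dotv x x.
Proof.
rewrite /enorm sqr_sqrtr; last by apply: sumr_ge0 => k _; rewrite sqr_ge0.
by apply: eq_bigr => k _; rewrite expr2.
Qed.

Lemma enorm_le x a : 0 <= a -> dotv x x <= a ^+ 2 -> enorm x <= a.
Proof. by move=> a0; rewrite -enormE ler_pXn2r ?nnegrE ?enorm_ge0. Qed.

Lemma enorm0 : enorm (0 : 'cV[R]_n) = 0.
Proof.
by apply/eqP; rewrite eq_le enorm_ge0 andbT enorm_le // dotv0r expr0n.
Qed.

Lemma enorm_eq0 x : enorm x = 0 -> x = 0.
Proof.
move=> h; have := enormE x; rewrite h expr0n /= => /esym /eqP.
rewrite psumr_eq0 => [/allP H|k _]; last by rewrite -expr2 sqr_ge0.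
apply/matrixP=> k j; rewrite ord1 [RHS]mxE; apply/eqP.
by have := H k (mem_index_enum _); rewrite mulf_eq0 orbb.
Qed.

Lemma enormZ a x : enorm (a *: x) = `|a| * enorm x.
Proof.
apply/eqP; rewrite -(@eqrXn2 _ 2) ?mulr_ge0 ?enorm_ge0 //.
by rewrite exprMn !enormE real_normK ?num_real // !dotvE mulrA.
Qed.

Lemma enormN x : enorm (- x) = enorm x.
Proof. by rewrite -scaleN1r enormZ normrN1 mul1r. Qed.

Lemma enorm_subC x y : enorm (x - y) = enorm (y - x).
Proof. by rewrite -enormN opprB. Qed.

Lemma dotv_cauchy x y : `|dotv x y| <= enorm x * enorm y.
Proof.
have key a b : 0 <= a ^+ 2 * dotv x x + b ^+ 2 * dotv y y + 2 * a * b * dotv x y.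
  by have := dotv_ge0 (a *: x + b *: y); rewrite !dotvE (dotvC y x); nra.
have X := enormE x; have Y := enormE y.
have x0 := enorm_ge0 x; have y0 := enorm_ge0 y.
have [ex|xn] := eqVneq (enorm x) 0.
  by rewrite ex (enorm_eq0 ex) dotvC dotv0r normr0 mul0r.
have [ey|yn] := eqVneq (enorm y) 0.
  by rewrite ey (enorm_eq0 ey) dotv0r normr0 mulr0.
have xp : 0 < enorm x by rewrite lt_neqAle eq_sym xn.
have yp : 0 < enorm y by rewrite lt_neqAle eq_sym yn.
have xyp : 0 < enorm x * enorm y by rewrite mulr_gt0.
have k1 := key (enorm y) (- enorm x); have k2 := key (enorm y) (enorm x).
rewrite -X -Y in k1 k2.
rewrite ler_norml; apply/andP; split; rewrite -(ler_pM2l xyp); nra.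
Qed.

Lemma dotv_le x y : dotv x y <= enorm x * enorm y.
Proof. exact: le_trans (ler_norm _) (dotv_cauchy x y). Qed.

Lemma enormD x y : enorm (x + y) <= enorm x + enorm y.
Proof.
apply: enorm_le; first by rewrite addr_ge0 ?enorm_ge0.
rewrite !dotvE (dotvC y x) -!enormE; have := dotv_le x y; nra.
Qed.

Lemma enormB x y : enorm (x - y) <= enorm x + enorm y.
Proof. by rewrite -[enorm y]enormN enormD. Qed.

Lemma enormB_ge x y : enorm x - enorm y <= enorm (x - y).
Proof. by rewrite lerBlDr; have := enormD (x - y) y; rewrite subrK. Qed.

Lemma enorm_sum (I : Type) (s : seq I) (P : pred I) (F : I -> 'cV[R]_n) :
  enorm (\sum_(i <- s | P i) F i) <= \sum_(i <- s | P i) enorm (F i).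
Proof.
apply: (big_rec2 (fun u v => enorm u <= v)) => [|i u v _ h]; first by rewrite enorm0.
by apply: le_trans (enormD _ _) _; rewrite lerD2l.
Qed.

Lemma enorm_coord x k : `|x k 0| <= enorm x.
Proof.
rewrite -(@ler_pXn2r _ 2) ?nnegrE ?enorm_ge0 // enormE real_normK ?num_real //.
rewrite /dotv (bigD1 k) //= expr2 lerDl; apply: sumr_ge0 => j _.
by rewrite -expr2 sqr_ge0.
Qed.

Lemma enorm_le_sum x : enorm x <= \sum_k `|x k 0|.
Proof.
have {1}-> : x = \sum_k x k 0 *: delta_mx k 0.
  apply/matrixP=> i j; rewrite ord1 summxE (bigD1 i) //= !mxE !eqxx mulr1.
  rewrite big1 ?addr0 // => k ki; rewrite !mxE eqxx andbT.
  by rewrite eq_sym (negPf ki) mulr0.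
apply: le_trans (enorm_sum _ _ _) _; apply: ler_sum => k _; rewrite enormZ.
rewrite -[leRHS]mulr1; apply: ler_wpM2l => //; apply: enorm_le => //.
rewrite /dotv (bigD1 k) //= !mxE !eqxx mulr1 big1 ?addr0 ?expr1n // => j jk.
by rewrite !mxE (negPf jk) mul0r.
Qed.

(* For y = N x with N symmetric and 0 <= N <= 2 kap this is |kap - N| <= kap; the
   inequality on y can be checked summand by summand, without spectral theory. *)
Lemma enorm_shift_le kap x y : 0 <= kap -> dotv y y <= 2 * kap * dotv x y ->
  enorm (kap *: x - y) <= kap * enorm x.
Proof.
move=> k0 h; apply: enorm_le; first by rewrite mulr_ge0 ?enorm_ge0.
rewrite exprMn enormE !dotvE (dotvC y x); nra.
Qed.

Lemma maskD K x y : mask K (x + y) = mask K x + mask K y.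
Proof. by apply/matrixP=> i j; rewrite !mxE; case: ifP; rewrite ?addr0. Qed.

Lemma maskZ K a x : mask K (a *: x) = a *: mask K x.
Proof. by apply/matrixP=> i j; rewrite !mxE; case: ifP; rewrite ?mulr0. Qed.

Lemma maskN K x : mask K (- x) = - mask K x.
Proof. by apply/matrixP=> i j; rewrite !mxE; case: ifP; rewrite ?oppr0. Qed.

Definition maskE := (maskD, maskN, maskZ).

Lemma mask_dscale K (D : 'I_n -> R) x : mask K (dscale D x) = dscale D (mask K x).
Proof. by apply/matrixP=> i j; rewrite !mxE; case: ifP; rewrite ?mulr0. Qed.

Lemma dscale_mask_const K (D : 'I_n -> R) a x :
  (forall k, K k -> D k = a) -> dscale D (mask K x) = a *: mask K x.
Proof.
by move=> h; apply/matrixP=> i j; rewrite !mxE; case: ifP => [/h ->|]; rewrite ?mulr0.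
Qed.

Lemma mask_split K x : x = mask K x + mask (predC K) x.
Proof.
by apply/matrixP=> i j; rewrite !mxE /= ord1; case: (K i); rewrite /= ?addr0 ?add0r.
Qed.

Lemma dotv_mask_predC K x y : dotv (mask K x) (mask (predC K) y) = 0.
Proof.
by apply: big1 => k _; rewrite !mxE /=; case: (K k); rewrite /= ?mulr0 ?mul0r.
Qed.

Lemma dotv_split K x y :
  dotv x y = dotv (mask K x) (mask K y) + dotv (mask (predC K) x) (mask (predC K) y).
Proof.
rewrite {1}(mask_split K x) {1}(mask_split K y) !dotvE dotv_mask_predC.
by rewrite (dotvC (mask (predC K) x)) dotv_mask_predC; ring.
Qed.

Lemma enorm_split K x :
  enorm x ^+ 2 = enorm (mask K x) ^+ 2 + enorm (mask (predC K) x) ^+ 2.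
Proof. by rewrite !enormE (dotv_split K). Qed.

Lemma enorm_mask_le K x : enorm (mask K x) <= enorm x.
Proof.
apply: enorm_le; first exact: enorm_ge0.
by rewrite (enorm_split K) !enormE lerDl dotv_ge0.
Qed.

Lemma enorm_le_mask K x : enorm x <= enorm (mask K x) + enorm (mask (predC K) x).
Proof. by rewrite {1}(mask_split K x) enormD. Qed.

End Vectors.

Lemma dotv_mulmx (R : realType) n m (A : 'M[R]_(n, m)) (x : 'cV[R]_n) (y : 'cV[R]_m) :
  dotv x (A *m y) = dotv (A^T *m x) y.
Proof.
rewrite /dotv; under eq_bigr do rewrite mxE mulr_sumr.
rewrite exchange_big /=; apply: eq_bigr => k _; rewrite mxE mulr_suml.
by apply: eq_bigr => j _; rewrite mxE; ring.
Qed.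

Lemma enorm_orth (R : realType) n (V : 'M[R]_n) (x : 'cV[R]_n) :
  V^T *m V = 1%:M -> enorm (V *m x) = enorm x.
Proof.
move=> h; apply/eqP; rewrite -(@eqrXn2 _ 2) ?enorm_ge0 //.
by rewrite !enormE dotv_mulmx mulmxA h mul1mx.
Qed.

(** * One column with converged predecessors *)

Section PairDynamics.
Context {R : realType} {n : nat}.
Variables (D : 'I_n -> R) (K : pred 'I_n) (al lam gam r : R).
Hypotheses (al_gt0 : 0 < al) (gam_gt0 : 0 < gam) (lamgam : lam + gam <= 0).
Hypotheses (r_ge0 : 0 <= r) (al_r : al * r ^+ 2 <= 1 / 10).
Hypothesis DK : forall k, K k -> D k = lam.
Hypothesis DQ : forall k, ~~ K k -> lam + gam <= D k <= lam + gam + r ^+ 2.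
Implicit Types x y w d e z : 'cV[R]_n.
Local Notation P := (mask K).
Local Notation Q := (mask (predC K)).

(** On the range of [Q], both corrections to the multiple [kap] are positive semidefinite: [D - mu]
    by the gap, and the rank-one term in [w]. Each satisfies y . y <= kap (Q z . y), and adding the
    two costs exactly the factor 2 that [enorm_shift_le] tolerates. *)
Lemma complement_contract w z (s : R) : 0 <= s <= r ^+ 2 -> enorm w <= 2 * r ->
  enorm ((1 - al * s) *: Q z - al *: dscale D (Q z) - (al / 2 * dotv w (Q z)) *: w)
    <= (1 - al * (lam + gam + s)) * enorm (Q z).
Proof.
have [H1 H2 H3 H4] := And4 gam_gt0 lamgam r_ge0 al_r.
move=> /andP[s0 sr] wr; set mu : R := lam + gam; set kap : R := 1 - al * (mu + s).
have als : al * s <= al * r ^+ 2 by apply: ler_wpM2l => //; exact: ltW.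
have kap9 : 9 / 10 <= kap.
  have : al * mu <= 0 by rewrite pmulr_rle0.
  by move=> hm; rewrite /kap mulrDr; lra.
pose y1 := dscale (fun k => al * (D k - mu)) (Q z).
pose y2 := (al / 2 * dotv w (Q z)) *: w.
have -> : (1 - al * s) *: Q z - al *: dscale D (Q z) - y2 = kap *: Q z - (y1 + y2).
  rewrite opprD addrA; congr (_ - _).
  by apply/matrixP=> k j; rewrite ord1 !mxE /=; case: (K k) => /=; rewrite /kap; ring.
apply: enorm_shift_le; first by lra.
have h1 : dotv y1 y1 <= kap * dotv (Q z) y1.
  rewrite /dotv mulr_sumr; apply: ler_sum => k _; rewrite !mxE /=.
  case: (boolP (K k)) => Kk /=; first by rewrite !(mulr0, mul0r).
  have /andP[d1 d2] := DQ Kk; rewrite -/mu in d1 d2.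
  set c := al * (D k - mu); set u := z k 0.
  have c0 : 0 <= c by rewrite mulr_ge0 ?subr_ge0 // ltW.
  have cr : c <= al * r ^+ 2 by apply: ler_wpM2l; [exact: ltW|lra].
  have -> : c * u * (c * u) = c * (c * u ^+ 2) by ring.
  have -> : kap * (u * (c * u)) = kap * (c * u ^+ 2) by ring.
  by apply: ler_wpM2r; [rewrite mulr_ge0 ?sqr_ge0|lra].
have h2 : dotv y2 y2 <= kap * dotv (Q z) y2.
  rewrite /y2 !dotvE -enormE (dotvC (Q z) w); set t := dotv w _.
  have -> : al / 2 * t * (al / 2 * t * enorm w ^+ 2)
     = (al / 2 * enorm w ^+ 2) * (al / 2 * t ^+ 2) by ring.
  have -> : kap * (al / 2 * t * t) = kap * (al / 2 * t ^+ 2) by ring.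
  apply: ler_wpM2r; first by rewrite mulr_ge0 ?sqr_ge0 // divr_ge0 // ltW.
  have : enorm w ^+ 2 <= (2 * r) ^+ 2.
    by rewrite ler_pXn2r ?nnegrE ?enorm_ge0 ?mulr_ge0.
  move=> h; have : al / 2 * enorm w ^+ 2 <= al / 2 * (2 * r) ^+ 2.
    by apply: ler_wpM2l => //; rewrite divr_ge0 // ltW.
  lra.
clearbody y1 y2.
have h3 : dotv (y1 + y2) (y1 + y2) <= 2 * (dotv y1 y1 + dotv y2 y2).
  by have := dotv_ge0 (y1 - y2); rewrite !dotvE (dotvC y2 y1); lra.
by rewrite (dotvDr y1 y2 (Q z)); lra.
Qed.

(** [d'] is the difference of two updated columns as rewritten by [col_next_sub]. Since both points
    lie in the thin cone, |P w| <= 2 r eta, which makes the coupling between the two blocks the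
    small [zeta]. What is left of the rank-one term acts inside the range of [Q] and is absorbed by
    [complement_contract]. *)
Lemma pair_step x y e eta kc th (d := x - y) (w := x + y)
    (s := (enorm x ^+ 2 + enorm y ^+ 2) / 2)
    (zeta := 2 * r ^+ 2 * eta * (1 + kc) + th)
    (d' := (1 - al * s) *: d - al *: dscale D d - (al / 2 * dotv w d) *: w - al *: e) :
  enorm x <= r -> enorm y <= r -> 0 <= eta -> 1 <= kc -> 0 <= th ->
  enorm (P x) <= eta * enorm (Q x) -> enorm (P y) <= eta * enorm (Q y) ->
  enorm (Q d) <= kc * enorm (P d) -> enorm e <= th * enorm (P d) ->
  (1 - al * (lam + s) - al * zeta) * enorm (P d) <= enorm (P d') /\
  enorm (Q d') <= (1 - al * (lam + gam + s)) * enorm (Q d) + al * zeta * enorm (P d).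
Proof.
have [H1 H2 H3 H4] := And4 gam_gt0 lamgam r_ge0 al_r.
move=> xr yr eta0 kc1 th0 px py qd ed.
have al0 := ltW al_gt0; have al20 : 0 <= al / 2 by rewrite divr_ge0.
have s0 : 0 <= s by rewrite divr_ge0 ?addr_ge0 ?sqr_ge0.
have xr2 : enorm x ^+ 2 <= r ^+ 2 by rewrite ler_pXn2r ?nnegrE ?enorm_ge0.
have yr2 : enorm y ^+ 2 <= r ^+ 2 by rewrite ler_pXn2r ?nnegrE ?enorm_ge0.
have sr : s <= r ^+ 2 by rewrite /s; lra.
have wr : enorm w <= 2 * r by have := enormD x y; rewrite -/w; lra.
have pw : enorm (P w) <= 2 * r * eta.
  rewrite /w maskD; apply: le_trans (enormD _ _) _.
  have : eta * enorm (Q x) <= eta * r.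
    by apply: ler_wpM2l => //; exact: le_trans (enorm_mask_le _ _) xr.
  have : eta * enorm (Q y) <= eta * r.
    by apply: ler_wpM2l => //; exact: le_trans (enorm_mask_le _ _) yr.
  lra.
have dd : enorm d <= (1 + kc) * enorm (P d).
  by have := enorm_le_mask K d; lra.
have p0 := enorm_ge0 (P d).
have r0 : 0 <= 2 * r by rewrite mulr_ge0.
have re0 : 0 <= 2 * r * eta by rewrite mulr_ge0.
clearbody d w s; split.
- have -> : P d' = (1 - al * (lam + s)) *: P d
      - ((al / 2 * dotv w d) *: P w + al *: P e).
    rewrite /d' !maskE mask_dscale (dscale_mask_const _ DK).
    by apply/matrixP=> i j; rewrite !mxE; case: (K i) => /=; ring.
  apply: le_trans (enormB_ge _ _); rewrite enormZ.
  have : (1 - al * (lam + s)) * enorm (P d) <= `|1 - al * (lam + s)| * enorm (P d).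
    by apply: ler_wpM2r => //; exact: ler_norm.
  have : enorm ((al / 2 * dotv w d) *: P w + al *: P e) <= al * zeta * enorm (P d).
    apply: le_trans (enormD _ _) _; rewrite !enormZ normrM (ger0_norm al0) (ger0_norm al20).
    have h1 : `|dotv w d| <= 2 * r * ((1 + kc) * enorm (P d)).
      by apply: le_trans (dotv_cauchy _ _) _; apply: ler_pM => //; exact: enorm_ge0.
    have h2 : `|dotv w d| * enorm (P w) <= 2 * r * ((1 + kc) * enorm (P d)) * (2 * r * eta).
      by apply: ler_pM => //; exact: enorm_ge0.
    have h3 : al / 2 * (`|dotv w d| * enorm (P w)) <=
        al / 2 * (2 * r * ((1 + kc) * enorm (P d)) * (2 * r * eta)).
      by apply: ler_wpM2l => //; rewrite divr_ge0.
    have h4 : al * enorm (P e) <= al * (th * enorm (P d)).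
      by apply: ler_wpM2l => //; exact: le_trans (enorm_mask_le _ _) ed.
    by rewrite /zeta; lra.
  lra.
- have -> : Q d' = ((1 - al * s) *: Q d - al *: dscale D (Q d)
        - (al / 2 * dotv (Q w) (Q d)) *: Q w)
      - ((al / 2 * dotv (P w) (P d)) *: Q w + al *: Q e).
    rewrite /d' !maskE mask_dscale (dotv_split K w d).
    by apply/matrixP=> i j; rewrite !mxE /=; case: (K i) => /=; ring.
  apply: le_trans (enormB _ _) _; apply: lerD.
    apply: complement_contract; first by rewrite s0.
    exact: le_trans (enorm_mask_le _ _) wr.
  apply: le_trans (enormD _ _) _; rewrite !enormZ normrM (ger0_norm al0) (ger0_norm al20).
  have h1 : `|dotv (P w) (P d)| <= 2 * r * eta * enorm (P d).
    apply: le_trans (dotv_cauchy _ _) _; apply: ler_pM => //; exact: enorm_ge0.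
  have h2 : `|dotv (P w) (P d)| * enorm (Q w) <= 2 * r * eta * enorm (P d) * (2 * r).
    by apply: ler_pM => //; [exact: enorm_ge0|exact: le_trans (enorm_mask_le _ _) wr].
  have h3 : al / 2 * (`|dotv (P w) (P d)| * enorm (Q w)) <=
      al / 2 * (2 * r * eta * enorm (P d) * (2 * r)).
    by apply: ler_wpM2l => //; rewrite divr_ge0.
  have h4 : al * enorm (Q e) <= al * (th * enorm (P d)).
    by apply: ler_wpM2l => //; exact: le_trans (enorm_mask_le _ _) ed.
  have h5 : 0 <= al * (2 * r ^+ 2 * eta * kc) * enorm (P d).
    by rewrite !mulr_ge0 ?sqr_ge0 //; lra.
  by rewrite /zeta; lra.
Qed.

End PairDynamics.

Lemma expr_unbounded (R : realType) (k M : R) : 1 < k -> exists h : nat, M < k ^+ h.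
Proof.
move=> k1; have bern h : 1 + h%:R * (k - 1) <= k ^+ h.
  elim: h => [|h IH]; first by rewrite mul0r addr0 expr0.
  rewrite exprS -natr1.
  have h0 : 0 <= h%:R :> R by [].
  have : k * (1 + h%:R * (k - 1)) <= k * k ^+ h by rewrite ler_pM2l //; lra.
  have : 0 <= h%:R * (k - 1) ^+ 2 by rewrite mulr_ge0 ?sqr_ge0.
  by move=> h1; apply: le_trans; lra.
have k10 : 0 < k - 1 by rewrite subr_gt0.
exists (Num.bound (`|M| / (k - 1))).
apply: lt_le_trans (bern _); apply: le_lt_trans (ler_norm M) _.
have /(archi_boundP) : 0 <= `|M| / (k - 1) by rewrite divr_ge0 // ltW.
by rewrite ltr_pdivrMr //; lra.
Qed.

(** [A - M] = al (gam - zeta - 2 eta) is at least al gam / 2; since M <= 2, this additive gap yields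
    the growth factor 1 + al gam / 4. *)
Lemma growth_factors (R : realType) (al lam gam r s eta zeta : R)
    (M := 1 - al * (lam + gam + s) + 2 * al * eta) (A := 1 - al * (lam + s) - al * zeta) :
  0 < al -> 0 < gam -> lam + gam <= 0 -> - r ^+ 2 <= lam -> al * r ^+ 2 <= 1 / 10 ->
  0 <= s -> s <= r ^+ 2 -> 0 <= eta -> eta <= gam / 8 -> zeta <= gam / 4 ->
  [/\ 1 / 2 <= M, M * (1 + al * gam / 4) <= A,
      0 <= 1 - al * (lam + gam + s) & 1 - al * (lam + gam + s) + al * zeta <= A].
Proof.
move=> al0 gam0 lamgam lamr alr s0 sr eta0 etag zg.
have algam : 0 < al * gam by rewrite mulr_gt0.
have als : al * s <= al * r ^+ 2 by rewrite ler_pM2l.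
have als0 : 0 <= al * s by rewrite mulr_ge0 // ltW.
have alz : al * zeta <= al * (gam / 4) by rewrite ler_pM2l.
have ale : al * eta <= al * (gam / 8) by rewrite ler_pM2l.
have ale0 : 0 <= al * eta by rewrite mulr_ge0 // ltW.
have almu : al * (lam + gam) <= 0 by rewrite pmulr_rle0.
have allam : al * (- r ^+ 2) <= al * lam by rewrite ler_pM2l.
have M0 : 1 / 2 <= M by rewrite /M; lra.
have M2 : M <= 2 by rewrite /M; lra.
split; [exact: M0| |by lra|by rewrite /A; lra].
have : M * (al * gam / 4) <= 2 * (al * gam / 4) by apply: ler_wpM2r => //; lra.
by rewrite mulrDr mulr1 /A /M; lra.
Qed.

(** Here p, q stand for |P d|, |Q d| and z for their coupling: the cone is invariant because p grows
    at least at rate a, which exceeds the rate b of q by z or more. *)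
Lemma cone_step (R : realType) (a b z kc p q p' q' : R) :
  0 <= b -> 1 <= kc -> 0 <= p -> b <= a -> b + z <= a ->
  q <= kc * p -> a * p <= p' -> q' <= b * q + z * p -> q' <= kc * p'.
Proof.
move=> b0 kc1 p0 ba bza qp app q'le; apply: (le_trans q'le).
have h1 : b * q <= b * (kc * p) by apply: ler_wpM2l.
have h2 : kc * (a * p) <= kc * p' by apply: ler_wpM2l => //; lra.
have h3 : 1 * (a - b) <= kc * (a - b) by apply: ler_wpM2r => //; lra.
have h4 : 0 <= (kc * (a - b) - z) * p by apply: mulr_ge0 => //; lra.
lra.
Qed.

(** With u = |P (x - y)|, v = |Q x|, w = |Q y|: the cone gives |v - w| <= (v + w) / 2, so v and w
    are within a factor 3 of each other and u^2 <= (v + w)^2 <= (16/3) v w. This is the bound that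
    geometric growth will violate. *)
Lemma cone_comparable (R : realType) (u v w kc eta : R) :
  0 < u -> 0 <= v -> 0 <= w -> eta <= 1 -> 0 <= kc -> eta * kc <= 1 / 2 ->
  u <= eta * (v + w) -> v - w <= kc * u -> w - v <= kc * u ->
  u ^+ 2 < 6 * (v * w).
Proof.
move=> u0 v0 w0 eta1 kc0 ek uvw d1 d2.
have vw0 : 0 <= v + w by rewrite addr_ge0.
have h1 : kc * u <= kc * (eta * (v + w)) by apply: ler_wpM2l.
have h2 : (eta * kc) * (v + w) <= 1 / 2 * (v + w) by apply: ler_wpM2r.
have h3 : eta * (v + w) <= 1 * (v + w) by apply: ler_wpM2r.
have h4 : u ^+ 2 <= (v + w) ^+ 2 by rewrite lerXn2r ?nnegrE //; lra.
have u2 : 0 < u ^+ 2 by rewrite exprn_gt0.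
have h5 : 0 <= ((v + w) / 2 - (v - w)) * ((v + w) / 2 - (w - v)).
  by apply: mulr_ge0; lra.
lra.
Qed.

Section ColumnDynamics.
Context {R : realType} {n : nat}.
Variables (D : 'I_n -> R) (K : pred 'I_n) (al lam gam r : R).
Hypotheses (al_gt0 : 0 < al) (gam_gt0 : 0 < gam) (lamgam : lam + gam <= 0).
Hypotheses (r_ge0 : 0 <= r) (al_r : al * r ^+ 2 <= 1 / 10).
Hypothesis lam_ge : - r ^+ 2 <= lam.
Hypothesis DK : forall k, K k -> D k = lam.
Hypothesis DQ : forall k, ~~ K k -> lam + gam <= D k <= lam + gam + r ^+ 2.
Local Notation P := (mask K).
Local Notation Q := (mask (predC K)).

(** One update of a column in eigenvector coordinates: [D] is the spectrum of the limiting deflated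
    operator, and [e] is the error caused by predecessors that have not yet converged. *)
Definition col_next (x e : 'cV[R]_n) : 'cV[R]_n :=
  (1 - al * enorm x ^+ 2) *: x - al *: dscale D x - al *: e.

Lemma col_next_P x e :
  P (col_next x e) = (1 - al * (lam + enorm x ^+ 2)) *: P x - al *: P e.
Proof.
rewrite /col_next !maskE mask_dscale (dscale_mask_const _ DK).
by apply/matrixP=> i j; rewrite !mxE; case: (K i) => /=; ring.
Qed.

Lemma col_next_Q x e : enorm x <= r ->
  enorm (Q (col_next x e)) <=
    (1 - al * (lam + gam + enorm x ^+ 2)) * enorm (Q x) + al * enorm e.
Proof.
move=> xr; rewrite /col_next !maskE mask_dscale.
apply: le_trans (enormB _ _) _; apply: lerD; last first.
  rewrite enormZ ger0_norm; last exact: ltW.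
  by apply: ler_wpM2l; [exact: ltW|exact: enorm_mask_le].
have := @complement_contract _ _ D K al lam gam r al_gt0 gam_gt0 lamgam r_ge0
  al_r DQ 0 x (enorm x ^+ 2).
rewrite scaler0 subr0; apply; last by rewrite enorm0 mulr_ge0.
by rewrite sqr_ge0 ler_pXn2r ?nnegrE ?enorm_ge0.
Qed.

Lemma col_next_Q_cone x e (eta : R) : 0 <= eta -> eta <= 1 -> enorm x <= r ->
  enorm e <= eta * enorm x -> enorm (P x) <= eta * enorm (Q x) ->
  enorm (Q (col_next x e)) <=
    (1 - al * (lam + gam + enorm x ^+ 2) + 2 * al * eta) * enorm (Q x).
Proof.
move=> eta0 eta1 xr ex px; apply: le_trans (col_next_Q _ xr) _.
have q0 := enorm_ge0 (Q x).
have h1 : enorm x <= 2 * enorm (Q x).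
  have h2 : eta * enorm (Q x) <= 1 * enorm (Q x) by apply: ler_wpM2r.
  have := enorm_le_mask K x; lra.
have h3 : al * enorm e <= al * (eta * (2 * enorm (Q x))).
  by rewrite ler_pM2l //; apply: (le_trans ex); apply: ler_wpM2l.
lra.
Qed.

(** The symmetric splitting of the cubic term: x - y receives the averaged coefficient [s], and
    |x|^2 - |y|^2 = (x + y) . (x - y) turns the remainder into a rank-one term. *)
Lemma col_next_sub x y e f (s := (enorm x ^+ 2 + enorm y ^+ 2) / 2) :
  col_next x e - col_next y f = (1 - al * s) *: (x - y) - al *: dscale D (x - y)
    - (al / 2 * dotv (x + y) (x - y)) *: (x + y) - al *: (e - f).
Proof.
have -> : dotv (x + y) (x - y) = enorm x ^+ 2 - enorm y ^+ 2.
  by rewrite !dotvE (dotvC y x) -!enormE; ring.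
rewrite /s; set a := enorm x ^+ 2; set b := enorm y ^+ 2.
by apply/matrixP=> i j; rewrite ord1 !mxE -/a -/b; field.
Qed.

(* The contradiction is reached at a horizon that depends on [eps] only: this
   uniformity is what makes the exceptional sets graphs with a modulus of
   continuity, so that no compactness is needed to see that they are null. *)
Lemma pair_separation (eta kc eps : R) :
  0 < eta -> eta <= 1 -> 1 <= kc -> eta * kc <= 1 / 2 -> eta <= gam / 8 ->
  2 * r ^+ 2 * eta * (1 + kc) + eta * (2 + kc) <= gam / 4 -> 0 < eps ->
  exists (h : nat) (tau : R), 0 < tau /\
   forall x y e f : nat -> 'cV[R]_n,
    (forall t, x t.+1 = col_next (x t) (e t)) ->
    (forall t, y t.+1 = col_next (y t) (f t)) ->
    (forall t, enorm (x t) <= r) -> (forall t, enorm (y t) <= r) ->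
    (forall t, enorm (e t) <= eta * enorm (x t)) ->
    (forall t, enorm (f t) <= eta * enorm (y t)) ->
    (forall t, enorm (P (x t)) <= eta * enorm (Q (x t))) ->
    (forall t, enorm (P (y t)) <= eta * enorm (Q (y t))) ->
    (forall t, (t < h)%N ->
       enorm (e t - f t) <= eta * enorm (x t - y t) + tau) ->
    enorm (Q (x 0 - y 0)) <= kc * enorm (P (x 0 - y 0)) ->
    enorm (P (x 0 - y 0)) < eps.
Proof.
move=> eta0 eta1 kc1 etakc etag zg eps0.
have [H1 H2 H3 H4] := And4 gam_gt0 lamgam r_ge0 al_r.
have [H5 H6] := conj al_gt0 lam_ge.
set zeta := (X in X <= gam / 4) in zg.
have zeta0 : 0 <= zeta.
  have kc0 : 0 <= kc by lra.
  by apply: addr_ge0; rewrite !mulr_ge0 ?sqr_ge0 ?addr_ge0 // ltW.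
(* [c] bounds the initial quotient from below: |P d|^2 >= eps^2 and |Q x| |Q y| <= r^2. The added 1
   keeps the denominator positive. *)
set g := 1 + al * gam / 4; set c := eps ^+ 2 / (r ^+ 2 + 1).
have algam : 0 < al * gam by rewrite mulr_gt0.
have r20 : 0 <= r ^+ 2 := sqr_ge0 r.
have r10 : 0 < r ^+ 2 + 1 by lra.
have c0 : 0 < c by rewrite divr_gt0 ?exprn_gt0.
(* The horizon at which the quotient exceeds the constant 6 of [cone_comparable]. *)
have [h hh] : exists h : nat, 6 / c < (g ^+ 2) ^+ h.
  by apply: expr_unbounded; rewrite /g; nra.
(* Since A >= 1/2, one step at most halves |P d|; up to time h the absolute error [tau] therefore
   stays below eta |P d| and can be counted as a relative error. *)
exists h, (eta * (eps / 2 ^+ h)); split.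
  by rewrite mulr_gt0 // divr_gt0 // exprn_gt0.
move=> x y e f xS yS xr yr ex fy px py ef qd0; rewrite ltNge; apply/negP => epd.
pose d t := x t - y t.
pose b t := enorm (Q (x t)) * enorm (Q (y t)).
have inv t : (t <= h)%N -> [/\ enorm (Q (d t)) <= kc * enorm (P (d t)),
    eps / 2 ^+ t <= enorm (P (d t))
  & (g ^+ 2) ^+ t * c * b t <= enorm (P (d t)) ^+ 2].
  elim: t => [_|t IH th].
    split; [exact: qd0|by rewrite expr0 divr1|rewrite expr0 mul1r].
    have xq : b 0 <= r * r.
      apply: ler_pM; rewrite ?enorm_ge0 //; exact: le_trans (enorm_mask_le _ _) _.
    have ep : eps ^+ 2 <= enorm (P (d 0)) ^+ 2.
      by rewrite ler_pXn2r ?nnegrE ?enorm_ge0 // ltW.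
    apply: le_trans ep; rewrite /c mulrAC ler_pdivrMr //.
    by apply: ler_wpM2l; rewrite ?sqr_ge0 //; lra.
  have [q1 p1 b1] := IH (ltnW th).
  have p0 := enorm_ge0 (P (d t)).
  have taut : eta * (eps / 2 ^+ h) <= eta * enorm (P (d t)).
    rewrite ler_pM2l //; apply: le_trans p1; rewrite ler_pM2l //.
    by rewrite lef_pV2 ?posrE ?exprn_gt0 // ler_weXn2l ?ler1n // ltnW.
  have dn : enorm (d t) <= (1 + kc) * enorm (P (d t)).
    by have := enorm_le_mask K (d t); lra.
  have efd : enorm (e t - f t) <= eta * (2 + kc) * enorm (P (d t)).
    have h1 := ef t th.
    have h2 : eta * enorm (d t) <= eta * ((1 + kc) * enorm (P (d t))).
      by rewrite ler_pM2l.
    rewrite -/(d t) in h1; lra.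
  have dS : d t.+1 = col_next (x t) (e t) - col_next (y t) (f t).
    by rewrite /d xS yS.
  set s := (enorm (x t) ^+ 2 + enorm (y t) ^+ 2) / 2.
  have [pS qS] := @pair_step _ _ D K al lam gam r al_gt0 gam_gt0 lamgam r_ge0 al_r
    DK DQ (x t) (y t) (e t - f t) eta kc (eta * (2 + kc)) (xr t) (yr t) (ltW eta0) kc1
    (mulr_ge0 (ltW eta0) (addr_ge0 (ler0n _ 2) (le_trans ler01 kc1)))
    (px t) (py t) q1 efd.
  rewrite -col_next_sub -dS -/s -/zeta -/(d t) in pS qS.
  have s0 : 0 <= s by rewrite divr_ge0 ?addr_ge0 ?sqr_ge0.
  have xr2 : enorm (x t) ^+ 2 <= r ^+ 2 by rewrite ler_pXn2r ?nnegrE ?enorm_ge0.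
  have yr2 : enorm (y t) ^+ 2 <= r ^+ 2 by rewrite ler_pXn2r ?nnegrE ?enorm_ge0.
  have sr : s <= r ^+ 2 by rewrite /s; lra.
  set M := 1 - al * (lam + gam + s) + 2 * al * eta.
  set A := 1 - al * (lam + s) - al * zeta in pS.
  have [M0 AM G0 GA] := growth_factors H5 H1 H2 H6 H4 s0 sr (ltW eta0) etag zg.
  rewrite -/M -/A -/g in M0 AM GA.
  have g1 : 1 <= g by rewrite lerDl divr_ge0 // ltW.
  have A1 : 1 / 2 <= A.
    by apply: le_trans AM; rewrite -[leLHS]mulr1; apply: ler_pM.
  split.
  - apply: (cone_step G0 kc1 p0 _ GA q1 pS qS).
    apply: le_trans GA; rewrite lerDl; apply: mulr_ge0; first exact: ltW.
    exact: zeta0.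
  - apply: le_trans pS; have : 1 / 2 * enorm (P (d t)) <= A * enorm (P (d t)).
      by apply: ler_wpM2r.
    apply: le_trans; rewrite exprS invfM mulrCA mul1r.
    by apply: ler_wpM2l.
  - have bS : b t.+1 <= M ^+ 2 * b t.
      rewrite /b xS yS.
      apply: (@le_trans _ _
        ((1 - al * (lam + gam + enorm (x t) ^+ 2) + 2 * al * eta) * enorm (Q (x t)) *
        ((1 - al * (lam + gam + enorm (y t) ^+ 2) + 2 * al * eta) * enorm (Q (y t))))).
        by apply: ler_pM; rewrite ?enorm_ge0 // col_next_Q_cone // ltW.
      rewrite mulrACA; apply: ler_wpM2r; first by rewrite mulr_ge0 ?enorm_ge0.
      (* The product of the two individual factors is at most the square of their mean, which is
         [M]. *)
      rewrite /M /s; set X := enorm (x t) ^+ 2; set Y := enorm (y t) ^+ 2.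
      rewrite -subr_ge0.
      have -> : (1 - al * (lam + gam + (X + Y) / 2) + 2 * al * eta) ^+ 2 -
        (1 - al * (lam + gam + X) + 2 * al * eta) *
        (1 - al * (lam + gam + Y) + 2 * al * eta) = (al * (X - Y) / 2) ^+ 2 by field.
      exact: sqr_ge0.
    have Mg0 : 0 <= M * g by apply: mulr_ge0; [exact: le_trans M0|exact: le_trans g1].
    have A0 : 0 <= A := le_trans Mg0 AM.
    have h1 : (M * g) ^+ 2 <= A ^+ 2 by rewrite lerXn2r ?nnegrE.
    have h2 : A ^+ 2 * enorm (P (d t)) ^+ 2 <= enorm (P (d t.+1)) ^+ 2.
      by rewrite -exprMn lerXn2r ?nnegrE ?enorm_ge0 // mulr_ge0.
    apply: le_trans h2.
    have g0 : 0 <= (g ^+ 2) ^+ t by rewrite exprn_ge0 ?sqr_ge0.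
    have h3 : (M * g) ^+ 2 * ((g ^+ 2) ^+ t * c * b t) <= A ^+ 2 * enorm (P (d t)) ^+ 2.
      apply: ler_pM => //; rewrite ?sqr_ge0 //.
      by apply: mulr_ge0; [apply: mulr_ge0 => //; exact: ltW|apply: mulr_ge0; exact: enorm_ge0].
    apply: le_trans h3; rewrite exprS.
    have -> : (M * g) ^+ 2 * ((g ^+ 2) ^+ t * c * b t) =
       g ^+ 2 * (g ^+ 2) ^+ t * c * (M ^+ 2 * b t) by ring.
    apply: ler_wpM2l bS; apply: mulr_ge0; last exact: ltW.
    by apply: mulr_ge0 => //; exact: sqr_ge0.
have [q1 p1 b1] := inv h (leqnn h).
have bh0 : 0 <= b h by rewrite mulr_ge0 ?enorm_ge0.
have b6 : 6 * b h <= enorm (P (d h)) ^+ 2.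
  apply: le_trans b1; apply: ler_wpM2r => //.
  by rewrite -ler_pdivrMr // ltW.
have pp : 0 < enorm (P (d h)).
  by apply: lt_le_trans p1; rewrite divr_gt0 // exprn_gt0.
have psum : enorm (P (d h)) <= eta * (enorm (Q (x h)) + enorm (Q (y h))).
  rewrite /d maskD maskN; apply: le_trans (enormB _ _) _.
  by rewrite mulrDr lerD.
have dif1 : enorm (Q (x h)) - enorm (Q (y h)) <= kc * enorm (P (d h)).
  apply: le_trans q1; rewrite /d maskD maskN; exact: enormB_ge.
have dif2 : enorm (Q (y h)) - enorm (Q (x h)) <= kc * enorm (P (d h)).
  apply: le_trans q1; rewrite /d maskD maskN enorm_subC; exact: enormB_ge.
have kc0 : 0 <= kc := le_trans ler01 kc1.
have := cone_comparable pp (enorm_ge0 _) (enorm_ge0 _) eta1 kc0 etakc psum dif1 dif2.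
by rewrite ltNge b6.
Qed.

End ColumnDynamics.

(** * Exponentially decaying sequences *)

Definition expdec (R : realType) (u : nat -> R) : Prop :=
  exists C q : R, [/\ 0 < q, q < 1 & forall t, `|u t| <= C * q ^+ t].

Section ExponentialDecay.
Context {R : realType}.
Implicit Types (u v e : nat -> R).

Lemma expdec_le (M : R) u v :
  expdec v -> (forall t, `|u t| <= M * `|v t|) -> expdec u.
Proof.
move=> [C [q [q0 q1 h]]] uv; exists (`|M| * C), q; split=> // t.
apply: (le_trans (uv t)); rewrite -mulrA.
apply: (@le_trans _ _ (`|M| * `|v t|)); last exact: ler_wpM2l.
by apply: ler_wpM2r => //; exact: ler_norm.
Qed.

Lemma eq_expdec u v : expdec v -> (forall t, u t = v t) -> expdec u.
Proof. by move=> hv uv; apply: (expdec_le (M := 1) hv) => t; rewrite uv mul1r. Qed.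

Lemma expdecD u v : expdec u -> expdec v -> expdec (fun t => u t + v t).
Proof.
move=> [C [q [q0 q1 h]]] [C' [q' [q0' q1' h']]].
exists (C + C'), (Num.max q q'); split; rewrite ?lt_max ?gt_max ?q0 ?q1 //.
move=> t; apply: le_trans (ler_normD _ _) _; rewrite mulrDl.
have C0 : 0 <= C by have := h 0; rewrite expr0 mulr1; apply: le_trans.
have C0' : 0 <= C' by have := h' 0; rewrite expr0 mulr1; apply: le_trans.
apply: lerD.
  apply: (le_trans (h t)); apply: ler_wpM2l => //.
  by apply: lerXn2r; rewrite ?nnegrE ?le_max ?lexx ?(ltW q0).
apply: (le_trans (h' t)); apply: ler_wpM2l => //.
by apply: lerXn2r; rewrite ?nnegrE ?le_max ?lexx ?(ltW q0) ?(ltW q0') ?orbT.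
Qed.

Lemma expdec0 : expdec (fun=> 0 : R).
Proof.
by exists 0, (1 / 2); split=> [||t]; [lra|lra|rewrite normr0 mul0r].
Qed.

Lemma expdec_sum (I : Type) (s : seq I) (P : pred I) (F : I -> nat -> R) :
  (forall i, P i -> expdec (F i)) -> expdec (fun t => \sum_(i <- s | P i) F i t).
Proof.
move=> h; elim: s => [|i s IH].
  by apply: (eq_expdec expdec0) => t; rewrite big_nil.
case Pi: (P i).
  by apply: (eq_expdec (expdecD (h i Pi) IH)) => t; rewrite big_cons Pi.
by apply: (expdec_le (M := 1) IH) => t; rewrite big_cons Pi mul1r.
Qed.

Lemma expdec_tail T u : expdec u -> expdec (fun t => u (t + T)%N).
Proof.
move=> [C [q [q0 q1 h]]]; exists (C * q ^+ T), q; split=> // t.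
by rewrite -mulrA -exprD addnC.
Qed.

Lemma expdec_shift T u : expdec (fun t => u (t + T)%N) -> expdec u.
Proof.
elim: T u => [|T IH] u hu.
  by apply: (eq_expdec hu) => t; rewrite addn0.
have [|C [q [q0 q1 h]]] := IH (fun t => u t.+1).
  by apply: (eq_expdec hu) => t; rewrite addnS.
exists (`|u 0| + C / q), q; split=> //.
have C0 : 0 <= C by have := h 0; rewrite expr0 mulr1; apply: le_trans.
case=> [|t]; first by rewrite expr0 mulr1 lerDl divr_ge0 // ltW.
have -> : (`|u 0| + C / q) * q ^+ t.+1 = `|u 0| * q ^+ t.+1 + C * q ^+ t.
  by rewrite exprS; field; rewrite gt_eqF.
apply: (le_trans (h t)); rewrite lerDr.
by rewrite !mulr_ge0 ?exprn_ge0 // ltW.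
Qed.

Lemma expr_small (q : R) (e : R) : 0 < q -> q < 1 -> 0 < e ->
  exists T : nat, forall t, (T <= t)%N -> q ^+ t <= e.
Proof.
move=> q0 q1 e0.
have [|T hT] := @expr_unbounded R q^-1 e^-1; first by rewrite invf_gt1.
exists T => t Tt; apply: (@le_trans _ _ (q ^+ T)).
  by apply: ler_wiXn2l => //; exact: ltW.
by rewrite ltW // -ltf_pV2 ?posrE ?exprn_gt0 // -exprVn.
Qed.

Lemma expdec_small u (e : R) : expdec u -> 0 < e ->
  exists T : nat, forall t, (T <= t)%N -> `|u t| <= e.
Proof.
move=> [C [q [q0 q1 h]]] e0.
have C0 : 0 <= C by have := h 0; rewrite expr0 mulr1; apply: le_trans.
have [|T hT] := @expr_small q (e / (C + 1)) q0 q1; first by rewrite divr_gt0 //; lra.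
exists T => t /hT; rewrite ler_pdivlMr; last by lra.
have := h t; have : 0 <= q ^+ t by rewrite exprn_ge0 // ltW.
nra.
Qed.

Lemma expdec_const (c : R) : expdec (fun=> c) -> c = 0.
Proof.
move=> hc; apply/eqP; rewrite -normr_le0 leNgt; apply/negP => c0.
have [|T /(_ T (leqnn _))] := expdec_small hc (e := `|c| / 2); first by lra.
lra.
Qed.

Lemma expdec_rec (kap : R) u e : 0 <= kap -> kap < 1 -> expdec e ->
  (forall t, `|u t.+1| <= kap * `|u t| + `|e t|) -> expdec u.
Proof.
move=> k0 k1 [C [q [q0 q1 h]]] hu.
(* A rate strictly above both [kap] and [q]: when the two coincide, the recursion only gives t
   kap^t, which this rate still dominates. *)
set p := (1 + Num.max kap q) / 2.
have mk : kap <= Num.max kap q by rewrite le_max lexx.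
have mq : q <= Num.max kap q by rewrite le_max lexx orbT.
have m1 : Num.max kap q < 1 by rewrite gt_max k1.
have [kp qp p1] : [/\ kap < p, q < p & p < 1] by rewrite /p; split; lra.
have p0 : 0 < p by lra.
have C0 : 0 <= C by have := h 0; rewrite expr0 mulr1; apply: le_trans.
exists (`|u 0| + C / (p - kap)), p; split=> //.
elim=> [|t IH]; first by rewrite expr0 mulr1 lerDl divr_ge0 //; lra.
apply: (le_trans (hu t)).
have e1 : `|e t| <= C * p ^+ t.
  apply: (le_trans (h t)); apply: ler_wpM2l => //.
  by apply: lerXn2r; rewrite ?nnegrE ?(ltW q0) ?(ltW p0) // ltW.
have h1 : kap * `|u t| <= kap * ((`|u 0| + C / (p - kap)) * p ^+ t).
  exact: ler_wpM2l.
have pt : 0 <= p ^+ t by rewrite exprn_ge0 // ltW.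
have pk : 0 < p - kap by lra.
have h2 : C * p ^+ t = (p - kap) * (C / (p - kap)) * p ^+ t.
  by congr (_ * _); rewrite mulrC divfK // gt_eqF.
have h3 : 0 <= (p - kap) * `|u 0| * p ^+ t by rewrite !mulr_ge0 // ltW.
rewrite exprS; move: h1 h2 h3; set c := C / (p - kap); lra.
Qed.

(** This is why rates are carried along: increments must be summable. With c q^t bounding the tail
    of the increments, u - c q^t increases and u + c q^t decreases, and the supremum of the former
    is the limit. *)
Lemma expdec_limit u : expdec (fun t => u t.+1 - u t) ->
  exists l : R, expdec (fun t => u t - l).
Proof.
move=> [C [q [q0 q1 h]]]; set c := C / (1 - q).
have q10 : 0 < 1 - q by lra.
have C0 : 0 <= C by have := h 0; rewrite expr0 mulr1; apply: le_trans.
have c0 : 0 <= c by rewrite divr_ge0 // ltW.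
have hc t : C * q ^+ t = c * q ^+ t - c * q ^+ t.+1.
  by rewrite exprS -{1}[C](divfK (lt0r_neq0 q10)) -/c; ring.
have lo s t : (s <= t)%N -> u s - c * q ^+ s <= u t - c * q ^+ t.
  elim: t => [|t IH]; first by rewrite leqn0 => /eqP ->.
  rewrite leq_eqVlt => /predU1P[-> //|/IH/le_trans]; apply.
  by have := h t; rewrite hc ler_norml; lra.
have hi s t : (s <= t)%N -> u t + c * q ^+ t <= u s + c * q ^+ s.
  elim: t => [|t IH]; first by rewrite leqn0 => /eqP ->.
  rewrite leq_eqVlt => /predU1P[-> //|/IH]; apply: le_trans.
  by have := h t; rewrite hc ler_norml; lra.
have cq t : 0 <= c * q ^+ t by rewrite mulr_ge0 // exprn_ge0 // ltW.
pose A := range (fun t => u t - c * q ^+ t).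
have ubA t : ubound A (u t + c * q ^+ t).
  move=> _ [s _ <-]; have [st|ts] := leqP s t.
    by apply: le_trans (lo _ _ st) _; have := cq t; lra.
  by apply: le_trans (hi _ _ (ltnW ts)); have := cq s; lra.
have supA : has_sup A.
  split; first by exists (u 0 - c * q ^+ 0), 0.
  by exists (u 0 + c * q ^+ 0).
exists (sup A), c, q; split=> // t; rewrite ler_norml; apply/andP; split.
  by have := ge_sup (proj1 supA) (ubA t); lra.
have : u t - c * q ^+ t <= sup A by apply: ub_le_sup; [case: supA|exists t].
lra.
Qed.

Lemma expdec_vec n (x : nat -> 'cV[R]_n) :
  (forall k, expdec (fun t => x t k 0)) -> expdec (fun t => enorm (x t)).
Proof.
move=> h; apply: (@expdec_le 1 _ (fun t => \sum_k `|x t k 0|)).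
  apply: expdec_sum => k _; apply: (expdec_le (M := 1) (h k)) => t.
  by rewrite normr_id mul1r.
move=> t; rewrite mul1r !ger0_norm ?enorm_ge0 ?enorm_le_sum //.
by apply: sumr_ge0 => k _; exact: normr_ge0.
Qed.

(* The radial equation a' = a (1 + al (sig^2 - a^2)): near 0 it expands, so a
   stays away from 0, and then a - sig contracts. *)
Lemma radial_convergence (al sig r : R) (a del : nat -> R) :
  0 < al -> 0 < sig -> sig <= r -> al * r ^+ 2 <= 1 / 10 ->
  (forall t, 0 < a t <= r) -> expdec del ->
  (forall t, `|a t.+1 - a t * (1 + al * (sig ^+ 2 - a t ^+ 2))| <= al * del t * a t) ->
  expdec (fun t => a t - sig).
Proof.
move=> al0 sig0 sigr alr; have r0 : 0 < r by lra.
(* Dropping an initial segment makes the perturbation at most a quarter of the linear growth rate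
   sig^2. *)
wlog small : a del / forall t, `|del t| <= sig ^+ 2 / 4.
  move=> W ar hd ha.
  have [|T hT] := expdec_small hd (e := sig ^+ 2 / 4); first by rewrite divr_gt0 ?exprn_gt0.
  apply: (@expdec_shift T).
  apply: (W (fun t => a (t + T)%N) (fun t => del (t + T)%N)) => [t|t||t].
  - by apply: hT; rewrite leq_addl.
  - exact: ar.
  - exact: expdec_tail.
  - exact: ha.
move=> ar hd ha.
have sr2 : sig ^+ 2 <= r ^+ 2 by rewrite lerXn2r ?nnegrE // ltW.
have alsr : al * sig ^+ 2 <= al * r ^+ 2 by rewrite ler_pM2l.
have sig2 : 0 < sig ^+ 2 by rewrite exprn_gt0.
set m := Num.min (a 0) (sig / 4).
have m0 : 0 < m by rewrite lt_min (andP (ar 0)).1 divr_gt0.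
have ms : m <= sig / 4 by rewrite ge_min lexx orbT.
have am t : m <= a t.
  elim: t => [|t IH]; first by rewrite ge_min lexx.
  have /andP[at0 atr] := ar t.
  have at2 : a t ^+ 2 <= r ^+ 2 by rewrite lerXn2r ?nnegrE // ltW.
  have alat : al * a t ^+ 2 <= al * r ^+ 2 by rewrite ler_pM2l.
  have alat0 : 0 <= al * a t ^+ 2 by rewrite mulr_ge0 ?sqr_ge0 // ltW.
  have als0 : 0 <= al * sig ^+ 2 by rewrite mulr_ge0 ?sqr_ge0 // ltW.
  have dl : del t <= sig ^+ 2 / 4 := le_trans (ler_norm _) (small t).
  have h1 : a t * (1 + al * (sig ^+ 2 - a t ^+ 2) - al * (sig ^+ 2 / 4)) <= a t.+1.
    have := ha t; rewrite ler_norml => /andP[+ _].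
    have : al * del t * a t <= al * (sig ^+ 2 / 4) * a t.
      by rewrite ler_pM2r // ler_pM2l.
    lra.
  apply: le_trans h1.
  (* If a^2 <= sig^2 / 2, the net factor is at least 1; otherwise a >= sig / 2, and a single step
     cannot even halve it, which is where sig / 4 in [m] comes from. *)
  have [le2|gt2] := lerP (a t ^+ 2) (sig ^+ 2 / 2).
    apply: (le_trans IH); rewrite ler_peMr //; first exact: ltW.
    have : al * a t ^+ 2 <= al * (sig ^+ 2 / 2) by rewrite ler_pM2l.
    lra.
  have s2 : sig / 2 <= a t.
    rewrite -(@ler_pXn2r _ 2) ?nnegrE ?divr_ge0 // ?ltW //.
    by rewrite expr_div_n; lra.
  apply: (@le_trans _ _ (a t * (1 / 2))); first by lra.
  by rewrite ler_pM2l //; lra.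
apply: (@expdec_rec (1 - al * (m * sig)) _ (fun t => al * r * del t)).
- have : al * (m * sig) <= al * r ^+ 2 by rewrite ler_pM2l // expr2; apply: ler_pM; lra.
  lra.
- by rewrite ltrBlDr ltrDl !mulr_gt0.
- by apply: (expdec_le (M := al * r) hd) => t; rewrite normrM gtr0_norm ?mulr_gt0.
move=> t; have /andP[at0 atr] := ar t; have mt := am t.
have -> : a t.+1 - sig = (1 - al * (a t * (sig + a t))) * (a t - sig) +
    (a t.+1 - a t * (1 + al * (sig ^+ 2 - a t ^+ 2))) by ring.
apply: le_trans (ler_normD _ _) _; apply: lerD.
  rewrite normrM ger0_norm.
    apply: ler_wpM2r => //; rewrite lerD2l lerN2 ler_pM2l //.
    by apply: ler_pM; lra.
  have : a t * (sig + a t) <= r * (r + r) by apply: ler_pM; lra.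
  by rewrite -(ler_pM2l al0); lra.
apply: (le_trans (ha t)); rewrite normrM (gtr0_norm (mulr_gt0 al0 r0)).
have h1 : al * del t * a t <= al * `|del t| * a t.
  by rewrite ler_pM2r // ler_pM2l // ler_norm.
have h2 : al * `|del t| * a t <= al * `|del t| * r.
  by apply: ler_wpM2l => //; rewrite mulr_ge0 // ltW.
lra.
Qed.

End ExponentialDecay.

(** * Convergence of a column outside the exceptional cone *)

Lemma ratio_step (R : realType) (G ee g a b a' b' : R) :
  0 < g -> g <= 1 / 10 -> 9 / 10 <= G -> G <= 11 / 10 -> 0 <= ee -> ee <= g / 8 ->
  0 < a -> 0 <= b -> (G - ee) * a <= a' -> b' <= (G - g) * b + ee * a ->
  0 < a' /\ b' / a' <= (1 - g / 2) * (b / a) + 4 * ee.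
Proof.
move=> g0 g1 G0 G1 ee0 eeg a0 b0 aa' bb'.
have a'0 : 0 < a' by apply: lt_le_trans aa'; rewrite mulr_gt0 //; lra.
split=> //; rewrite ler_pdivrMr //; apply: (le_trans bb').
(* The factor [G], which varies with |x|, is common to both components and nearly cancels in the
   ratio, so the gap [g] survives as a contraction. *)
set w := b / a; have bE : b = w * a by rewrite divfK // gt_eqF.
have w0 : 0 <= w by rewrite divr_ge0 // ltW.
clearbody w; subst b.
have k0 : 0 <= (1 - g / 2) * w + 4 * ee by apply: addr_ge0; apply: mulr_ge0; lra.
apply: le_trans (ler_wpM2l k0 aa').
have -> : (G - g) * (w * a) + ee * a = ((G - g) * w + ee) * a by ring.
rewrite mulrA ler_pM2r //.
have i1 : 1 * ee <= 4 * (G - ee) * ee by apply: ler_wpM2r => //; lra.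
have i2 : (G - g) * w <= (1 - g / 2) * (G - ee) * w.
  by apply: ler_wpM2r => //; nra.
lra.
Qed.

Section GoodColumn.
Context {R : realType} {n : nat}.
Variables (D : 'I_n -> R) (K : pred 'I_n) (al lam gam r : R).
Hypotheses (al_gt0 : 0 < al) (gam_gt0 : 0 < gam) (lamgam : lam + gam <= 0).
Hypotheses (r_ge0 : 0 <= r) (al_r : al * r ^+ 2 <= 1 / 10).
Hypothesis lam_ge : - r ^+ 2 <= lam.
Hypothesis DK : forall k, K k -> D k = lam.
Hypothesis DQ : forall k, ~~ K k -> lam + gam <= D k <= lam + gam + r ^+ 2.
Local Notation P := (mask K).
Local Notation Q := (mask (predC K)).

Lemma good_column (x e : nat -> 'cV[R]_n) (eps : nat -> R) (Om : R) :
  1 <= Om -> (forall t, x t.+1 = col_next D al (x t) (e t)) ->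
  (forall t, enorm (x t) <= r) ->
  (forall t, enorm (e t) <= eps t * enorm (x t)) ->
  expdec eps -> (forall t, 0 <= eps t) ->
  (forall t, (1 + Om) * eps t <= gam / 8) ->
  0 < enorm (P (x 0)) -> enorm (Q (x 0)) <= Om * enorm (P (x 0)) ->
  exists z, [/\ P z = z, enorm z = Num.sqrt (- lam) &
    expdec (fun t => enorm (x t - z))].
Proof.
move=> Om1 xS xr ex heps eps0 epsg p0 q0.
have [H1 H2 H3 H4] := And4 gam_gt0 lamgam r_ge0 al_r.
have [H5 H6] := conj al_gt0 lam_ge.
have al0 := ltW al_gt0.
pose a t : R := enorm (P (x t)); pose b t : R := enorm (Q (x t)).
(* On the cone |Q x| <= Om |P x| the norm |x| is at most (1 + Om) |P x|, so [E] measures the error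
   relative to |P x|. *)
pose E t : R := (1 + Om) * eps t.
have E0 t : 0 <= E t by rewrite mulr_ge0 //; lra.
have hE : expdec E.
  apply: (expdec_le (M := 1 + Om) heps) => t.
  by rewrite normrM ger0_norm //; lra.
have a0 t : 0 <= a t := enorm_ge0 _.
have b0 t : 0 <= b t := enorm_ge0 _.
have ar t : a t <= r := le_trans (enorm_mask_le _ _) (xr t).
have br t : b t <= r := le_trans (enorm_mask_le _ _) (xr t).
have algam : 0 < al * gam by rewrite mulr_gt0.
have algr : al * gam <= al * r ^+ 2 by rewrite ler_pM2l //; lra.
have alE t : al * E t <= al * gam / 8 by rewrite -mulrA ler_pM2l // epsg.
have alE0 t : 0 <= al * E t by rewrite mulr_ge0.
have allam : al * (- r ^+ 2) <= al * lam by rewrite ler_pM2l.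
have allam0 : al * lam <= 0 by rewrite pmulr_rle0 //; lra.
pose N t : R := enorm (x t) ^+ 2.
have NE t : N t = a t ^+ 2 + b t ^+ 2 := enorm_split _ _.
have N0 t : 0 <= N t := sqr_ge0 _.
have alN0 t : 0 <= al * N t by rewrite mulr_ge0.
have alN t : al * N t <= al * r ^+ 2.
  by rewrite ler_pM2l // lerXn2r ?nnegrE ?enorm_ge0.
pose gg t : R := 1 - al * (lam + N t).
have gg1 t : 9 / 10 <= gg t by rewrite /gg; have := alN t; lra.
have gg2 t : gg t <= 11 / 10 by rewrite /gg; have := alN0 t; lra.
have eE t : b t <= Om * a t -> enorm (e t) <= E t * a t.
  move=> ba; apply: (le_trans (ex t)).
  have -> : E t * a t = eps t * ((1 + Om) * a t) by rewrite /E; ring.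
  apply: ler_wpM2l => //; have := enorm_le_mask K (x t).
  by rewrite -/(a t) -/(b t); lra.
have step t : b t <= Om * a t ->
   `|a t.+1 - gg t * a t| <= al * E t * a t /\
   b t.+1 <= (gg t - al * gam) * b t + al * E t * a t.
  move=> ba; have ea := eE t ba; split.
    have h : enorm (al *: P (e t)) <= al * E t * a t.
      rewrite enormZ ger0_norm // -mulrA ler_pM2l //.
      exact: le_trans (enorm_mask_le _ _) ea.
    have ggn : enorm (gg t *: P (x t)) = gg t * a t.
      by rewrite enormZ ger0_norm //; have := gg1 t; lra.
    rewrite /a xS (col_next_P _ DK) -/(N t) -/(gg t) -/(a t) -ggn ler_norml.
    apply/andP; split.
      by have := enormB_ge (gg t *: P (x t)) (al *: P (e t)); lra.
    by have := enormB (gg t *: P (x t)) (al *: P (e t)); lra.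
  rewrite /b xS; apply: (le_trans (@col_next_Q _ _ D K al lam gam r al_gt0 gam_gt0 lamgam r_ge0 al_r DQ _ (e t) (xr t))).
  apply: lerD; last by rewrite -mulrA ler_pM2l.
  by rewrite -/(N t) -/(b t) /gg; lra.
pose om t : R := b t / a t.
have algr1 : al * gam <= 1 / 10 := le_trans algr H4.
have omS t : 0 < a t -> b t <= Om * a t ->
    0 < a t.+1 /\ om t.+1 <= (1 - al * gam / 2) * om t + 4 * (al * E t).
  move=> at0 ba; have [] := step t ba; rewrite ler_norml => /andP[lo _] bS.
  apply: (ratio_step algam algr1 (gg1 t) (gg2 t) (alE0 t) (alE t) at0 (b0 t) _ bS).
  rewrite lerBrDr addrC in lo.
  by have -> : (gg t - al * E t) * a t = gg t * a t - al * E t * a t by ring.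
have cone t : 0 < a t /\ b t <= Om * a t.
  elim: t => [//|t [at0 ba]]; have [at1 omt] := omS t at0 ba; split=> //.
  rewrite -ler_pdivrMr //; apply: (le_trans omt).
  have h1 : (1 - al * gam / 2) * om t <= (1 - al * gam / 2) * Om.
    by apply: ler_wpM2l; [lra|rewrite ler_pdivrMr].
  have h2 : al * gam / 2 * 1 <= al * gam / 2 * Om.
    by apply: ler_wpM2l => //; rewrite divr_ge0 // ltW.
  have := alE t; lra.
have om0 t : 0 <= om t by rewrite divr_ge0.
have omE t : b t = om t * a t by rewrite divfK // gt_eqF // (cone t).1.
have homg : expdec om.
  apply: (@expdec_rec _ (1 - al * gam / 2) _ (fun t => 4 * (al * E t))).
  - by lra.
  - by lra.
  - apply: (expdec_le (M := 4 * al) hE) => t.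
    by rewrite !normrM (ger0_norm al0) (@ger0_norm _ 4) // mulrA.
  move=> t; rewrite !(ger0_norm (om0 _)) (ger0_norm (mulr_ge0 (ler0n _ 4) (alE0 t))).
  exact: (omS t (cone t).1 (cone t).2).2.
have hb : expdec b.
  apply: (expdec_le (M := r) homg) => t.
  rewrite (ger0_norm (b0 t)) (ger0_norm (om0 t)) omE mulrC.
  exact: ler_wpM2r.
set sig := Num.sqrt (- lam).
have sig2 : sig ^+ 2 = - lam by rewrite sqr_sqrtr //; lra.
have sig0 : 0 < sig by rewrite sqrtr_gt0; lra.
have sigr : sig <= r.
  by rewrite -(@ler_pXn2r _ 2) ?nnegrE ?(ltW sig0) // sig2; lra.
have ha : expdec (fun t => a t - sig).
  apply: (radial_convergence (del := fun t => r * b t + E t) al_gt0 sig0 sigr al_r).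
  - by move=> t; rewrite ar andbT; exact: (cone t).1.
  - apply: expdecD => //; apply: (expdec_le (M := r) hb) => t.
    by rewrite normrM (ger0_norm r_ge0).
  move=> t; rewrite sig2.
  have -> : a t.+1 - a t * (1 + al * (- lam - a t ^+ 2)) =
     (a t.+1 - gg t * a t) + - (al * (b t ^+ 2 * a t)).
    by rewrite /gg NE; ring.
  apply: le_trans (ler_normD _ _) _; rewrite normrN (@ger0_norm _ (al * _)); last first.
    by rewrite mulr_ge0 // mulr_ge0 ?sqr_ge0.
  have [h1 _] := step t (cone t).2.
  have h2 : al * (b t * b t * a t) <= al * (r * b t * a t).
    by rewrite ler_pM2l //; apply: ler_wpM2r => //; exact: ler_wpM2r.
  rewrite expr2; lra.
have hN : expdec (fun t => lam + N t).
  apply: (expdec_le (M := 1) (v := fun t => 2 * r * `|a t - sig| + r * b t)).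
    apply: expdecD; [apply: (expdec_le (M := 2 * r) ha)|apply: (expdec_le (M := r) hb)].
      by move=> t; rewrite !normrM normr_id (ger0_norm r_ge0) (@ger0_norm _ 2).
    by move=> t; rewrite !normrM (ger0_norm r_ge0).
  move=> t; rewrite mul1r [leRHS]ger0_norm; last first.
    by rewrite addr_ge0 // mulr_ge0 // mulr_ge0.
  have -> : lam + N t = (a t + sig) * (a t - sig) + b t * b t.
    by rewrite NE -[lam]opprK -sig2; ring.
  apply: le_trans (ler_normD _ _) _; apply: lerD; rewrite normrM.
    apply: ler_wpM2r => //; rewrite ger0_norm; last by rewrite addr_ge0 // ltW.
    by have := ar t; lra.
  by rewrite (ger0_norm (b0 t)); apply: ler_wpM2r.
(* The direction inside the eigenspace also has to settle: the P part of an increment is al (lam +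
   |x|^2) P x plus an error, up to sign, so increments decay exponentially and each coordinate
   converges. *)
have hx : expdec (fun t => enorm (x t.+1 - x t)).
  apply: (expdec_le (M := 1)
    (v := fun t => al * r * (`|lam + N t| + E t) + (b t.+1 + b t))).
    apply: expdecD.
      apply: (expdec_le (M := al * r) (v := fun t => `|lam + N t| + E t)).
        apply: expdecD => //; apply: (expdec_le (M := 1) hN) => t.
        by rewrite normr_id mul1r.
      by move=> t; rewrite normrM (@ger0_norm _ (al * r)) // mulr_ge0.
    apply: expdecD => //; apply: (eq_expdec (expdec_tail 1 hb)) => t.
    by rewrite addn1.
  move=> t; rewrite mul1r (ger0_norm (enorm_ge0 _)) ger0_norm; last first.
    apply: addr_ge0; last exact: addr_ge0.
    by apply: mulr_ge0; [exact: mulr_ge0|exact: addr_ge0].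
  apply: (le_trans (enorm_le_mask K _)); rewrite !maskE; apply: lerD; last exact: enormB.
  rewrite {1}xS (col_next_P _ DK) -/(N t).
  have -> : (1 - al * (lam + N t)) *: P (x t) - al *: P (e t) - P (x t) =
    - ((al * (lam + N t)) *: P (x t) + al *: P (e t)).
    by apply/matrixP=> i j; rewrite !mxE; ring.
  rewrite enormN; apply: le_trans (enormD _ _) _; rewrite !enormZ normrM (ger0_norm al0).
  have h1 : al * `|lam + N t| * a t <= al * `|lam + N t| * r.
    by apply: ler_wpM2l => //; rewrite mulr_ge0.
  have h2 : al * enorm (P (e t)) <= al * (E t * r).
    rewrite ler_pM2l //; apply: le_trans (enorm_mask_le _ _) _.
    by apply: le_trans (eE t (cone t).2) _; apply: ler_wpM2l.
  by rewrite -/(a t); lra.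
have lim k : exists l, expdec (fun t => x t k 0 - l).
  apply: expdec_limit; apply: (expdec_le (M := 1) hx) => t.
  rewrite mul1r (ger0_norm (enorm_ge0 _)).
  by have := enorm_coord (x t.+1 - x t) k; rewrite !mxE.
have [l hl] := choice lim.
pose z : 'cV[R]_n := \col_k l k.
have hz : expdec (fun t => enorm (x t - z)).
  by apply: expdec_vec => k; apply: (eq_expdec (hl k)) => t; rewrite !mxE.
exists z; split=> //.
- have hQ : expdec (fun=> enorm (Q z)).
    apply: (expdec_le (M := 1) (expdecD hz hb)) => t.
    rewrite mul1r !ger0_norm ?addr_ge0 ?enorm_ge0 //.
    have -> : Q z = Q (x t) - Q (x t - z) by rewrite !maskE opprB addrC subrK.
    rewrite [leRHS]addrC; apply: le_trans (enormB _ _) _.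
    by rewrite lerD2l enorm_mask_le.
  by rewrite [RHS](mask_split K) (enorm_eq0 (expdec_const hQ)) addr0.
- have hs : expdec (fun=> enorm z - sig).
    apply: (expdec_le (M := 1)
      (v := fun t => enorm (x t - z) + (b t + `|a t - sig|))).
      do 2 apply: expdecD => //; apply: (expdec_le (M := 1) ha) => t.
      by rewrite normr_id mul1r.
    move=> t; rewrite mul1r [leRHS]ger0_norm ?addr_ge0 ?enorm_ge0 //.
    have h1 := enorm_le_mask K (x t); have h2 := enorm_mask_le K (x t).
    have h3 := enormB_ge (x t) z; have h4 := enormB_ge z (x t).
    rewrite (enorm_subC z) in h4; rewrite -/(a t) -/(b t) in h1 h2.
    have h5 := ler_norm (a t - sig).
    have h6 : - (a t - sig) <= `|a t - sig| by rewrite -normrN ler_norm.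
    by have bt := b0 t; rewrite ler_norml; lra.
  by apply/eqP; rewrite -subr_eq0; apply/eqP; exact: expdec_const hs.
Qed.

End GoodColumn.

(** * Null sets *)

Definition cube (R : realType) n p (c : 'M[R]_(n, p)) (r : R) : set 'M[R]_(n, p) :=
  [set X | forall i j, `|X i j - c i j| <= r].

(* Unlike covers by boxes, covers by cubes are transported by Lipschitz maps. *)
Definition cube_null (R : realType) n p (S : set 'M[R]_(n, p)) : Prop :=
  forall eps : R, 0 < eps ->
    exists (c : nat -> 'M[R]_(n, p)) (r : nat -> R),
      [/\ forall k, 0 <= r k, S `<=` \bigcup_k cube (c k) (r k)
        & forall N, \sum_(0 <= k < N) r k ^+ (n * p) <= eps].

Lemma ler_sum_uniq (R : realType) (T : eqType) (s t : seq T) (F : T -> R) :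
  uniq s -> uniq t -> {subset s <= t} -> (forall u, 0 <= F u) ->
  \sum_(u <- s) F u <= \sum_(u <- t) F u.
Proof.
move=> us ut st F0; rewrite [leRHS](bigID (mem s)) /= -[X in _ <= X + _]big_filter.
have /(perm_big _) -> : perm_eq [seq u <- t | u \in s] s.
  apply: uniq_perm; rewrite ?filter_uniq // => u; rewrite mem_filter.
  by case: (boolP (u \in s)) => //= /st.
by rewrite lerDl; apply: sumr_ge0.
Qed.

Section NullSets.
Context {R : realType} {n p : nat}.
Implicit Types S : set 'M[R]_(n, p).
Local Notation d := (n * p)%N.

Lemma cube_null_count S : (0 < d)%N ->
  (forall eps : R, 0 < eps -> exists (T : countType) (c : T -> 'M[R]_(n, p)) (r : T -> R),
     [/\ forall u, 0 <= r u, S `<=` \bigcup_u cube (c u) (r u)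
       & forall s : seq T, uniq s -> \sum_(u <- s) r u ^+ d <= eps]) ->
  cube_null S.
Proof.
move=> d0 H eps /H[T [c [r [r0 Sc sr]]]].
(* Numbers that code no index get radius 0; its power [d] vanishes because d > 0. *)
exists (fun k => oapp c 0 (pickle_inv k)), (fun k => oapp r 0 (pickle_inv k)); split.
- by move=> k; case: pickle_inv => /=.
- by move=> X /Sc[u _ Xu]; exists (pickle u) => //; rewrite pickleK_inv.
move=> N; rewrite /index_iota subn0.
have E (s : seq nat) : \sum_(k <- s) oapp r 0 (pickle_inv k) ^+ d =
    \sum_(u <- pmap (pickle_inv (T := T)) s) r u ^+ d.
  elim: s => [|k s IH]; first by rewrite !big_nil.
  rewrite big_cons IH /=; case: pickle_inv => [u|] /=; first by rewrite big_cons.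
  by rewrite expr0n eqn0Ngt d0 add0r.
by rewrite E; apply: sr; apply: (pmap_uniq pickle_invK); exact: iota_uniq.
Qed.

Lemma cube_null_bigcup (F : nat -> set 'M[R]_(n, p)) : (0 < d)%N ->
  (forall k, cube_null (F k)) -> cube_null (\bigcup_k F k).
Proof.
move=> d0 hF; apply: cube_null_count => // eps eps0.
have /choice[c /choice[r hr]] k := hF k (eps / 2 ^+ k.+1) (divr_gt0 eps0 (exprn_gt0 _ (ltr0n _ 2))).
exists (nat * nat)%type, (fun u => c u.1 u.2), (fun u => r u.1 u.2); split.
- by move=> u; have [+ _ _] := hr u.1.
- move=> X [k _ Xk]; have [_ h _] := hr k; have [j _ Xj] := h X Xk.
  by exists (k, j).
move=> s us.
have F0 (u : nat * nat) : 0 <= r u.1 u.2 ^+ d.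
  by have [+ _ _] := hr u.1; move=> h; rewrite exprn_ge0.
(* A finite list of pairs fits into a square, whose rows are summed separately. *)
pose M := (\max_(u <- s) (u.1 + u.2)).+1.
apply: (@le_trans _ _ (\sum_(u <- [seq (k, j) | k <- iota 0 M, j <- iota 0 M]) r u.1 u.2 ^+ d)).
  apply: ler_sum_uniq => //.
    by apply: allpairs_uniq; rewrite ?iota_uniq // => -[? ?] [? ?].
  move=> [k j] ks; have : (k + j < M)%N.
    by rewrite ltnS (@leq_bigmax_seq _ _ xpredT (fun u => u.1 + u.2)%N _ ks).
  move=> kj; apply/allpairsP; exists (k, j); rewrite !mem_iota /= !add0n; split=> //.
    exact: leq_ltn_trans (leq_addr _ _) kj.
  exact: leq_ltn_trans (leq_addl _ _) kj.
rewrite big_allpairs /=.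
apply: (@le_trans _ _ (\sum_(k <- iota 0 M) eps / 2 ^+ k.+1)).
  apply: ler_sum => k _; have [_ _ h] := hr k.
  by have := h M; rewrite /index_iota subn0.
have -> : iota 0 M = index_iota 0 M by rewrite /index_iota subn0.
have -> : \sum_(0 <= k < M) eps / 2 ^+ k.+1 = eps - eps / 2 ^+ M.
  elim: {us F0 s} M => [|m IH]; first by rewrite big_nil expr0 divr1 subrr.
  by rewrite big_nat_recr //= IH exprS; field; rewrite expf_neq0.
by rewrite gerBl divr_ge0 ?exprn_ge0 // ltW.
Qed.

Lemma cube_null_sub S S' : S `<=` S' -> cube_null S' -> cube_null S.
Proof.
move=> SS' hS' eps /hS'[c [r [r0 Sc sr]]]; exists c, r; split=> //.
exact: subset_trans Sc.
Qed.

Lemma cube_null0 : (0 < d)%N -> cube_null (set0 : set 'M[R]_(n, p)).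
Proof.
move=> d0 eps eps0; exists (fun=> 0), (fun=> 0); split=> // N.
by rewrite big1 ?ltW // => k _; rewrite expr0n eqn0Ngt d0.
Qed.

Lemma cube_nullU S S' : (0 < d)%N -> cube_null S -> cube_null S' ->
  cube_null (S `|` S').
Proof.
move=> d0 hS hS'; apply: (@cube_null_sub _ (\bigcup_k (if k == 0%N then S else S'))).
  by move=> X [XS|XS]; [exists 0%N|exists 1%N].
by apply: cube_null_bigcup => // -[|k].
Qed.

Lemma cube_null_count_bigcup (T : countType) (F : T -> set 'M[R]_(n, p)) :
  (0 < d)%N -> (forall u, cube_null (F u)) -> cube_null (\bigcup_u F u).
Proof.
move=> d0 hF; pose G k := oapp F set0 (pickle_inv (T := T) k).
apply: (@cube_null_sub _ (\bigcup_k G k)).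
  by move=> X [u _ Xu]; exists (pickle u) => //; rewrite /G pickleK_inv.
apply: cube_null_bigcup => // k; rewrite /G; case: pickle_inv => [u|] /=; first exact: hF.
exact: cube_null0.
Qed.

(** Only a Lipschitz inverse on [S'] is used. A cube of the given cover may be centred outside the
    image, so it is replaced by one centred at an actual point of [S'] mapped into it; this doubles
    the radius. *)
Lemma cube_null_preimage (f : 'M[R]_(n, p) -> 'M[R]_(n, p)) (L : R) S S' :
  0 <= L -> cube_null S -> (forall X, S' X -> S (f X)) ->
  (forall X Y B, S' X -> S' Y -> cube (f Y) B (f X) -> cube Y (L * B) X) ->
  cube_null S'.
Proof.
move=> L0 hS SS' lip eps eps0.
have C0 : 0 < (2 * L) ^+ d + 1 by rewrite ltr_pwDr // exprn_ge0 // mulr_ge0.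
have [c [r [r0 Sc sr]]] := hS (eps / ((2 * L) ^+ d + 1)) (divr_gt0 eps0 C0).
have /choice[c' hc'] k : exists Y, forall X, S' X -> cube (c k) (r k) (f X) ->
    cube Y (L * (2 * r k)) X.
  have [[Y [SY fY]]|no] := pselect (exists Y, S' Y /\ cube (c k) (r k) (f Y)).
    exists Y => X SX fX; apply: lip => // i j.
    have := fX i j; have := fY i j; rewrite !ler_norml => /andP[h1 h2] /andP[h3 h4].
    by apply/andP; split; lra.
  by exists 0 => X SX fX; case: no; exists X.
exists c', (fun k => L * (2 * r k)); split.
- by move=> k; rewrite !mulr_ge0.
- by move=> X SX; have [k _ fX] := Sc _ (SS' _ SX); exists k => //; exact: hc'.
move=> N; have := sr N; rewrite ler_pdivlMr // => h.
have -> : \sum_(0 <= k < N) (L * (2 * r k)) ^+ d =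
    (\sum_(0 <= k < N) r k ^+ d) * (2 * L) ^+ d.
  rewrite mulr_suml; apply: eq_bigr => k _; rewrite -exprMn; congr (_ ^+ _); ring.
apply: le_trans h; apply: ler_wpM2l; last by rewrite lerDl.
by apply: sumr_ge0 => k _; rewrite exprn_ge0.
Qed.

Lemma cube_null_measure_zero S : (0 < d)%N -> cube_null S -> measure_zero S.
Proof.
move=> d0 hS e e0; have e20 : 0 < e / 2 ^+ d by rewrite divr_gt0 // exprn_gt0.
have [c [r [r0 Sc sr]]] := hS _ e20.
exists (fun k => \matrix_(i, j) (c k i j - r k)), (fun k => \matrix_(i, j) (c k i j + r k)).
have vol k : box_volume (\matrix_(i, j) (c k i j - r k)) (\matrix_(i, j) (c k i j + r k))
    = 2 ^+ d * r k ^+ d.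
  transitivity (\prod_(i < n) \prod_(j < p) (2 * r k)).
    by apply: eq_bigr => i _; apply: eq_bigr => j _; rewrite !mxE; ring.
  rewrite (eq_bigr (fun=> (2 * r k) ^+ p)) => [|i _]; last by rewrite prodr_const card_ord.
  by rewrite prodr_const card_ord -exprM mulnC exprMn.
split.
- by move=> k i j; rewrite !mxE; have := r0 k; lra.
- move=> X /Sc[k _ Xk]; exists k => // i j; rewrite !mxE.
  by have := Xk i j; rewrite ler_norml => /andP[h1 h2]; apply/andP; split; lra.
apply: lime_le.
  by apply: is_cvg_nneseries => k _ _; rewrite vol lee_fin mulr_ge0 ?exprn_ge0.
near=> N; rewrite sumEFin lee_fin; under eq_bigr do rewrite vol.
by rewrite -mulr_sumr mulrC -ler_pdivlMr ?exprn_gt0.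
Unshelve. all: by end_near.
Qed.

End NullSets.

Lemma truncn_cell (R : realType) (h x : R) : 0 < h -> 0 <= x ->
  h * (Num.truncn (x / h))%:R <= x < h * (Num.truncn (x / h))%:R + h.
Proof.
move=> h0 x0; have := truncn_itv (divr_ge0 x0 (ltW h0)).
by rewrite ler_pdivlMr // ltr_pdivrMr // -natr1 => /andP[h1 h2]; apply/andP; split; lra.
Qed.

(* A set that is a graph over all coordinates but one, with a modulus of
   continuity: over each cube of a fine grid in the other coordinates it only
   needs few cubes stacked in the last direction. *)
Lemma graph_cube_null (R : realType) n p (S : set 'M[R]_(n, p)) (i0 : 'I_n)
    (j0 : 'I_p) (M : R) :
  0 <= M -> (forall X, S X -> forall i j, `|X i j| <= M) ->
  (forall eps : R, 0 < eps -> exists2 del : R, 0 < del & forall X Y, S X -> S Y ->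
     (forall i j, (i, j) != (i0, j0) -> `|X i j - Y i j| <= del) ->
     `|X i0 j0 - Y i0 j0| <= eps) ->
  cube_null S.
Proof.
move=> M0 SM modS.
have n0 : (0 < n)%N by apply: leq_ltn_trans (ltn_ord i0).
have p0 : (0 < p)%N by apply: leq_ltn_trans (ltn_ord j0).
have d0 : (0 < n * p)%N by rewrite muln_gt0 n0.
set d := (n * p)%N.
apply: cube_null_count => // eps eps0.
(* The grid has at most N + 1 steps in each of d - 1 directions and m + 1 in the last. With h <= 1
   and h <= e1, the total is at most (2 M + 1)^(d-1) * 3 e1 = C e1. *)
set C := (2 * M + 1) ^+ d.-1 * 3.
have C0 : 0 < C by rewrite mulr_gt0 // exprn_gt0 //; lra.
set e1 := Num.min 1 (eps / C).
have e10 : 0 < e1 by rewrite lt_min ltr01 divr_gt0.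
have [del del0 modX] := modS _ e10.
set h := Num.min del e1.
have h0 : 0 < h by rewrite lt_min del0.
have hdel : h <= del by rewrite ge_min lexx.
have he1 : h <= e1 by rewrite ge_min lexx orbT.
have h1 : h <= 1 by apply: (le_trans he1); rewrite ge_min lexx.
pose idx x := Num.truncn ((x + M) / h).
pose N := Num.truncn (2 * M / h).
pose m := Num.truncn (2 * e1 / h).
have idxP x : `|x| <= M -> (idx x < N.+1)%N.
  rewrite ler_norml => /andP[x1 x2]; rewrite ltnS; apply: le_truncn.
  by rewrite ler_pM2r ?invr_gt0 //; lra.
have idxE x : `|x| <= M -> h * (idx x)%:R - M <= x <= h * (idx x)%:R - M + h.
  rewrite ler_norml => /andP[x1 x2].
  have xM0 : 0 <= x + M by lra.
  by have /andP[y1 y2] := truncn_cell h0 xM0; apply/andP; rewrite /idx; split; lra.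
pose T' : finType := {u : 'I_n * 'I_p | u != (i0, j0)}.
pose T : finType := ({ffun T' -> 'I_N.+1} * 'I_m.+1)%type.
pose cell (X : 'M[R]_(n, p)) : {ffun T' -> 'I_N.+1} :=
  [ffun u : T' => inord (idx (X (val u).1 (val u).2))].
(* Each base cell that meets [S] gets one sample point; over that cell [S] stays within height [e1]
   of the sample, so a stack of length 2 e1 covers it. *)
have /choice[pt hpt] (psi : {ffun T' -> 'I_N.+1}) : exists Y, forall X, S X -> cell X = psi ->
    S Y /\ cell Y = psi.
  have [[Y hY]|no] := pselect (exists Y, S Y /\ cell Y = psi).
    by exists Y.
  by exists 0 => X SX cX; case: no; exists X.
pose c (u : T) : 'M[R]_(n, p) := \matrix_(i, j)
  (if insub (i, j) is Some v then h * (u.1 (v : T') : nat)%:R - M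
   else pt u.1 i0 j0 - e1 + h * (u.2 : nat)%:R).
exists T, c, (fun=> h); split; first by move=> _; exact: ltW.
- move=> X SX; have [SY cY] := hpt (cell X) X SX erefl.
  set Y := pt (cell X) in SY cY.
  have cX (v : T') Z : S Z -> cell Z v = idx (Z (val v).1 (val v).2) :> nat.
    by move=> SZ; rewrite ffunE inordK // idxP // SM.
  have XY0 : `|X i0 j0 - Y i0 j0| <= e1.
    apply: modX => // i j ij; apply: le_trans hdel.
    pose v : T' := exist _ (i, j) ij.
    have := idxE _ (SM _ SX i j); have := idxE _ (SM _ SY i j).
    have := cX v X SX; have := cX v Y SY; rewrite cY /= => -> ->.
    by rewrite ler_norml => /andP[? ?] /andP[? ?]; apply/andP; split; lra.
  move: XY0; rewrite ler_norml => /andP[y1 y2].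
  pose k := Num.truncn ((X i0 j0 - Y i0 j0 + e1) / h).
  have km : (k < m.+1)%N.
    by rewrite ltnS; apply: le_truncn; rewrite ler_pM2r ?invr_gt0 //; lra.
  exists (cell X, inord k) => // i j; rewrite mxE /=.
  case: insubP => [v _ vE|]; last first.
    rewrite negbK => /eqP[-> ->]; rewrite inordK // -/Y.
    have XY0 : 0 <= X i0 j0 - Y i0 j0 + e1 by lra.
    have /andP[] := truncn_cell h0 XY0.
    by rewrite -/k ler_norml => z1 z2; apply/andP; split; lra.
  rewrite (cX v X SX) vE /=; have := idxE _ (SM _ SX i j).
  by rewrite ler_norml => /andP[? ?]; apply/andP; split; lra.
move=> s us; rewrite big_const_seq count_predT iter_addr_0.
have sT : (size s <= #|T|)%N by rewrite -(card_uniqP us) max_card.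
apply: (@le_trans _ _ (h ^+ d *+ #|T|)); first by rewrite ler_wpMn2l // exprn_ge0 // ltW.
have -> : #|T| = (N.+1 ^ d.-1 * m.+1)%N.
  by rewrite card_prod card_ffun !card_ord card_sig cardC1 card_prod !card_ord.
have NM : h * N.+1%:R <= 2 * M + 1.
  have /andP[+ _] := @truncn_cell _ h (2 * M) h0 (mulr_ge0 (ler0n _ 2) M0).
  by rewrite -/N -natr1; lra.
have mM : h * m.+1%:R <= 3 * e1.
  have /andP[+ _] := @truncn_cell _ h (2 * e1) h0 (mulr_ge0 (ler0n _ 2) (ltW e10)).
  by rewrite -/m -natr1; lra.
have dE : h ^+ d = h * h ^+ d.-1 by rewrite -exprS prednK.
rewrite -mulr_natr natrM natrX dE.
have -> : h * h ^+ d.-1 * (N.+1%:R ^+ d.-1 * m.+1%:R) =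
  (h * N.+1%:R) ^+ d.-1 * (h * m.+1%:R) by rewrite exprMn; ring.
apply: (@le_trans _ _ ((2 * M + 1) ^+ d.-1 * (3 * e1))).
  apply: ler_pM => //.
  - by rewrite exprn_ge0 // mulr_ge0 // ltW.
  - by rewrite mulr_ge0 // ltW.
  - by apply: lerXn2r; rewrite ?nnegrE //; [rewrite mulr_ge0 // ltW|lra].
rewrite mulrA -/C mulrC -ler_pdivlMr //.
by rewrite ge_min lexx orbT.
Qed.

(** * The invariant box *)

Lemma spectral_norm_le (R : realType) n (A : 'M[R]_n) (x : 'cV[R]_n) :
  enorm (A *m x) <= spectral_norm A * enorm x.
Proof.
have ub : has_ubound [set enorm (A *m x) | x in [set x : 'cV[R]_n | enorm x <= 1]].
  exists (\sum_k \sum_l `|A k l|) => _ [y /= y1 <-].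
  apply: le_trans (enorm_le_sum _) _; apply: ler_sum => k _; rewrite mxE.
  apply: le_trans (ler_norm_sum _ _ _) _; apply: ler_sum => l _; rewrite normrM.
  rewrite -[leRHS]mulr1; apply: ler_wpM2l => //.
  exact: le_trans (enorm_coord _ _) y1.
have [x0|x0] := eqVneq (enorm x) 0.
  by rewrite (enorm_eq0 x0) mulmx0 enorm0 mulr0.
have xp : 0 < enorm x by rewrite lt_neqAle eq_sym x0 enorm_ge0.
have -> : enorm (A *m x) = enorm (A *m ((enorm x)^-1 *: x)) * enorm x.
  by rewrite -scalemxAr enormZ ger0_norm ?invr_ge0 ?enorm_ge0 // mulrAC mulVf ?mul1r.
rewrite ler_pM2r //; apply: ub_le_sup => //; exists ((enorm x)^-1 *: x) => //=.
by rewrite enormZ ger0_norm ?invr_ge0 ?enorm_ge0 // mulVf.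
Qed.

Lemma sum_cauchy (R : realType) p (P : pred 'I_p) (a b : 'I_p -> R) :
  (\sum_(j | P j) a j * b j) ^+ 2 <=
  (\sum_(j | P j) a j ^+ 2) * (\sum_(j | P j) b j ^+ 2).
Proof.
pose v (c : 'I_p -> R) : 'cV[R]_p := \col_j (if P j then c j else 0).
have E c c' : \sum_(j | P j) c j * c' j = dotv (v c) (v c').
  rewrite /dotv big_mkcond; apply: eq_bigr => j _; rewrite !mxE.
  by case: (P j); rewrite ?mulr0.
have E2 c : \sum_(j | P j) c j ^+ 2 = enorm (v c) ^+ 2.
  by rewrite enormE -E; apply: eq_bigr => j _; rewrite expr2.
rewrite E !E2 -exprMn -real_normK ?num_real // lerXn2r ?nnegrE ?mulr_ge0 ?enorm_ge0 //.
exact: dotv_cauchy.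
Qed.

(** The cube meant here is the cubic map |x|^2 x, not a set of matrices. *)
Lemma cube_diff_le (R : realType) n (x y : 'cV[R]_n) (r : R) :
  enorm x <= r -> enorm y <= r ->
  enorm (enorm x ^+ 2 *: x - enorm y ^+ 2 *: y) <= 3 * r ^+ 2 * enorm (x - y).
Proof.
move=> xr yr; have x0 := enorm_ge0 x; have y0 := enorm_ge0 y.
have -> : enorm x ^+ 2 *: x - enorm y ^+ 2 *: y = enorm x ^+ 2 *: (x - y)
    + ((enorm x - enorm y) * (enorm x + enorm y)) *: y.
  by apply/matrixP=> i j; rewrite !mxE; ring.
apply: le_trans (enormD _ _) _; rewrite !enormZ ger0_norm ?sqr_ge0 // normrM.
have d0 := enorm_ge0 (x - y).
have h1 : `|enorm x - enorm y| <= enorm (x - y).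
  have h1 := enormB_ge x y; have h2 := enormB_ge y x; rewrite (enorm_subC y) in h2.
  by rewrite ler_norml; lra.
have h2 : enorm x ^+ 2 * enorm (x - y) <= r ^+ 2 * enorm (x - y).
  by apply: ler_wpM2r => //; rewrite lerXn2r ?nnegrE //; lra.
have h3 : `|enorm x - enorm y| * `|enorm x + enorm y| * enorm y <=
    enorm (x - y) * (r + r) * r.
  apply: ler_pM; rewrite ?mulr_ge0 //.
  by apply: ler_pM => //; rewrite ger0_norm ?addr_ge0 // lerD.
lra.
Qed.

Definition deflated (R : realType) n p (A : 'M[R]_n) (X : 'M[R]_(n, p)) (i : nat)
    (x : 'cV[R]_n) : 'cV[R]_n :=
  A *m x + \sum_(j < p | (j < i)%N) dotv (col j X) x *: col j X.

Lemma col_step (R : realType) n p (A : 'M[R]_n) (alpha : R) (X : 'M[R]_(n, p)) i :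
  col i (X - alpha *: g A X) =
  col i X - alpha *: (deflated A X i (col i X) + enorm (col i X) ^+ 2 *: col i X).
Proof.
apply/matrixP=> k o; rewrite ord1 /deflated enormE !mxE !summxE; congr (_ - _ * _).
rewrite -addrA; congr (_ + _).
  by apply: eq_bigr => l _; rewrite !mxE.
rewrite (bigID (fun j : 'I_p => (j < i)%N)) /=; congr (_ + _).
  apply: eq_bigr => j ji; rewrite !mxE (ltnW ji) mulrC; congr (_ * _).
  by apply: eq_bigr => l _; rewrite !mxE.
rewrite (bigD1 i) /= ?ltnn // big1 ?addr0 => [|j /andP[ji jni]].
  rewrite !mxE leqnn mulrC; congr (_ * _).
  by apply: eq_bigr => l _; rewrite !mxE.
rewrite !mxE; case: ifP => [ij|]; last by rewrite mulr0.
by case/eqP: jni; apply/val_inj/eqP; rewrite eqn_leq ij leqNgt.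
Qed.

Lemma deflatedB (R : realType) n p (A : 'M[R]_n) (X : 'M[R]_(n, p)) i x y :
  deflated A X i (x - y) = deflated A X i x - deflated A X i y.
Proof.
rewrite /deflated mulmxBr opprD addrACA -sumrB; congr (_ + _).
by apply: eq_bigr => j _; rewrite dotvDr dotvNr scalerBl.
Qed.

Lemma deflated_diff (R : realType) n p (A : 'M[R]_n) (X Y : 'M[R]_(n, p)) i x (r : R) :
  (forall j : 'I_p, (j < i)%N -> enorm (col j X) <= r) ->
  (forall j : 'I_p, (j < i)%N -> enorm (col j Y) <= r) ->
  enorm (deflated A X i x - deflated A Y i x) <=
  2 * r * (\sum_(j < p | (j < i)%N) enorm (col j X - col j Y)) * enorm x.
Proof.
move=> Xr Yr; rewrite /deflated opprD addrACA subrr add0r -sumrB.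
apply: le_trans (enorm_sum _ _ _) _; rewrite mulr_sumr mulr_suml.
apply: ler_sum => j ji; set a := col j X; set b := col j Y.
have -> : dotv a x *: a - dotv b x *: b = dotv (a - b) x *: a + dotv b x *: (a - b).
  by rewrite dotvDl dotvNl; apply/matrixP=> k o; rewrite !mxE; ring.
apply: le_trans (enormD _ _) _; rewrite !enormZ.
have x0 := enorm_ge0 x; have ab0 := enorm_ge0 (a - b).
have h1 : `|dotv (a - b) x| * enorm a <= enorm (a - b) * enorm x * r.
  by apply: ler_pM; rewrite ?enorm_ge0 ?dotv_cauchy // Xr.
have h2 : `|dotv b x| * enorm (a - b) <= r * enorm x * enorm (a - b).
  apply: ler_wpM2r => //; apply: le_trans (dotv_cauchy _ _) _.
  by apply: ler_wpM2r => //; exact: Yr.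
lra.
Qed.

Section Box.
Context {R : realType} {n p : nat}.
Variables (A : 'M[R]_n) (alpha : R).
Local Notation rho := (spectral_norm A).
Local Notation r := (col_radius rho p).
Local Notation step := (fun X : 'M[R]_(n, p) => X - alpha *: g A X).
Hypotheses (symA : A^T = A) (rho_gt0 : 0 < rho) (alpha_gt0 : 0 < alpha).
Hypothesis alpha_r : alpha * r ^+ 2 <= 1 / 10.

Definition col_box : set 'M[R]_(n, p) :=
  [set X | forall i : 'I_p, enorm (col i X) <= col_radius rho i.+1].

Lemma col_radius_ge0 i : 0 <= col_radius rho i.
Proof. by rewrite mulr_ge0 ?exprn_ge0 ?sqrtr_ge0. Qed.

Lemma col_radiusE i : col_radius rho i.+1 ^+ 2 = 4 ^+ i * (3 * rho).
Proof.
rewrite /col_radius /= exprMn sqr_sqrtr; last by rewrite mulr_ge0 // ltW.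
have -> : 4 = 2 ^+ 2 :> R by ring.
by rewrite exprAC.
Qed.

Lemma col_radius_le i : (i < p)%N -> col_radius rho i.+1 <= r.
Proof.
move=> ip; apply: ler_wpM2r; first exact: sqrtr_ge0.
apply: ler_weXn2l; first by rewrite ler1n.
by case: p ip => [|p'] //.
Qed.

Lemma rho_le_radius i : 3 * rho <= col_radius rho i.+1 ^+ 2.
Proof.
rewrite col_radiusE; have : 1 * (3 * rho) <= 4 ^+ i * (3 * rho).
  by apply: ler_wpM2r; [rewrite mulr_ge0 // ltW|apply: exprn_ege1; rewrite ler1n].
by rewrite mul1r.
Qed.

(** The reason for doubling the radii: their squares form a geometric series of ratio 4, so all
    earlier ones together amount to at most a third of the current one. *)
Lemma sum_sqr_radius X (i : 'I_p) : col_box X ->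
  \sum_(j < p | (j < i)%N) enorm (col j X) ^+ 2 <= col_radius rho i.+1 ^+ 2 / 3.
Proof.
move=> bX; apply: (@le_trans _ _ (\sum_(j < p | (j < i)%N) 4 ^+ j * (3 * rho))).
  apply: ler_sum => j ji; rewrite -col_radiusE.
  by rewrite lerXn2r ?nnegrE ?enorm_ge0 ?col_radius_ge0.
rewrite -(big_ord_widen _ (fun j => 4 ^+ j * (3 * rho))) 1?ltnW //.
rewrite col_radiusE; elim: (nat_of_ord i) => [|k IH].
  by rewrite big_ord0 expr0; have := rho_gt0; lra.
rewrite big_ord_recr /= exprS; move: IH; set S := \sum_(j < k) _; lra.
Qed.

(** Shifting A by rho makes it positive semidefinite, as is the deflation, so [enorm_shift_le]
    leaves the scalar bound nu (1 + al rho - al nu^2). This increases with nu up to R_i, where R_i^2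
    >= 3 rho keeps it at most R_i. *)
Lemma box_invariant X : col_box X -> col_box (step X).
Proof.
move=> bX i; rewrite col_step.
set x := col i X; set ri := col_radius rho i.+1; set nu := enorm x.
have al0 := alpha_gt0; have r0 := rho_gt0.
have xr : nu <= ri := bX i.
have nu0 : 0 <= nu := enorm_ge0 _.
have ri0 : 0 <= ri := col_radius_ge0 _.
have alri : alpha * ri ^+ 2 <= 1 / 10.
  apply: le_trans alpha_r; rewrite ler_pM2l // lerXn2r ?nnegrE ?col_radius_ge0 //.
  exact: col_radius_le.
have rhor : 3 * rho <= ri ^+ 2 := rho_le_radius i.
have alrho : alpha * (3 * rho) <= alpha * ri ^+ 2 by rewrite ler_pM2l.
have alrho0 : 0 < alpha * rho by rewrite mulr_gt0.
have nu2 : nu ^+ 2 <= ri ^+ 2 by rewrite lerXn2r ?nnegrE.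
have alnu : alpha * nu ^+ 2 <= alpha * ri ^+ 2 by rewrite ler_pM2l.
set kap := 1 + alpha * rho - alpha * nu ^+ 2.
pose y1 := alpha *: (A *m x + rho *: x).
pose y2 := alpha *: (\sum_(j < p | (j < i)%N) dotv (col j X) x *: col j X).
have -> : x - alpha *: (deflated A X i x + nu ^+ 2 *: x) = kap *: x - (y1 + y2).
  rewrite /deflated -/y2 /kap /y1 !scalerDr !scalerDl -/y2 scale1r !scalerA !scaleNr !opprD.
  by apply/matrixP=> k o; rewrite !mxE; ring.
(* From |A x| <= rho |x| alone: y1 . y1 <= 2 al rho (x . y1), and 2 al rho <= kap. *)
have h1 : dotv y1 y1 <= kap * dotv x y1.
  have AA : dotv (A *m x) (A *m x) <= rho ^+ 2 * dotv x x.
    rewrite -!enormE -exprMn; apply: lerXn2r; last exact: spectral_norm_le.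
      by rewrite nnegrE enorm_ge0.
    by rewrite nnegrE mulr_ge0 ?enorm_ge0 // ltW.
  rewrite /y1 !dotvE (dotvC (A *m x) x) -/(dotv x x).
  set a := dotv (A *m x) _ in AA *; set b := dotv x (A *m x); set c := dotv x x in AA *.
  have b0 : 0 <= alpha * (b + rho * c).
    have : - (rho * c) <= b.
      have := dotv_cauchy x (A *m x); rewrite ler_norml -/b => /andP[+ _].
      apply: le_trans; rewrite lerN2 /c -enormE expr2 mulrCA.
      by apply: ler_wpM2l; [exact: enorm_ge0|exact: spectral_norm_le].
    by rewrite pmulr_rge0 //; lra.
  have : alpha * a <= alpha * (rho ^+ 2 * c) by rewrite ler_pM2l.
  move=> h; have h' : alpha * (alpha * a) <= alpha * (alpha * (rho ^+ 2 * c)).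
    by rewrite ler_pM2l.
  have k2 : 2 * alpha * rho <= kap by rewrite /kap; lra.
  have : 2 * alpha * rho * (alpha * (b + rho * c)) <= kap * (alpha * (b + rho * c)).
    by apply: ler_wpM2r.
  lra.
have h2 : dotv y2 y2 <= kap * dotv x y2.
  pose c j := dotv (col j X) x.
  have E1 : dotv x y2 = alpha * \sum_(j < p | (j < i)%N) c j ^+ 2.
    rewrite /y2 dotvZr dotv_sumr; congr (_ * _); apply: eq_bigr => j _.
    by rewrite dotvZr (dotvC x) expr2.
  have E2 : enorm (\sum_(j < p | (j < i)%N) c j *: col j X) ^+ 2 <=
     (\sum_(j < p | (j < i)%N) c j ^+ 2) * (\sum_(j < p | (j < i)%N) enorm (col j X) ^+ 2).
    have := sum_cauchy (fun j : 'I_p => (j < i)%N) (fun j => `|c j|) (fun j => enorm (col j X)).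
    under [X in _ <= X * _]eq_bigr do rewrite real_normK ?num_real //.
    apply: le_trans; rewrite lerXn2r ?nnegrE ?enorm_ge0 //.
      by apply: sumr_ge0 => j _; rewrite mulr_ge0 ?enorm_ge0.
    by apply: le_trans (enorm_sum _ _ _) _; apply: ler_sum => j _; rewrite enormZ.
  rewrite E1 /y2 !dotvE -enormE; set S := \sum_(j < p | _) _ ^+ 2 in E1 E2 *.
  have S0 : 0 <= S by apply: sumr_ge0 => j _; exact: sqr_ge0.
  have E3 := le_trans E2 (ler_wpM2l S0 (sum_sqr_radius i bX)).
  have : alpha * (alpha * enorm (\sum_(j < p | (j < i)%N) c j *: col j X) ^+ 2) <=
     alpha * (alpha * (S * (ri ^+ 2 / 3))) by rewrite !ler_pM2l.
  have k2 : alpha * ri ^+ 2 / 3 <= kap by rewrite /kap; lra.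
  have : alpha * ri ^+ 2 / 3 * (alpha * S) <= kap * (alpha * S).
    by apply: ler_wpM2r => //; rewrite mulr_ge0 // ltW.
  lra.
have h3 : dotv (y1 + y2) (y1 + y2) <= 2 * kap * dotv x (y1 + y2).
  rewrite (dotvDr y1 y2 x); clearbody y1 y2.
  by have := dotv_ge0 (y1 - y2); rewrite !dotvE (dotvC y2 y1); lra.
have k0 : 0 <= kap by rewrite /kap; lra.
apply: le_trans (enorm_shift_le k0 h3) _; rewrite -/nu.
(* [f1] is the monotonicity of the scalar bound between nu and R_i; [f2] is its value at R_i. *)
have f1 : 0 <= (ri - nu) * (1 + alpha * rho - alpha * (ri ^+ 2 + ri * nu + nu ^+ 2)).
  apply: mulr_ge0; first by lra.
  have : ri * nu <= ri * ri by apply: ler_wpM2l.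
  by rewrite -(ler_pM2l al0); lra.
have f2 : 0 <= ri * (alpha * ri ^+ 2 - alpha * rho) by apply: mulr_ge0 => //; lra.
by rewrite /kap; lra.
Qed.

(** The step is the identity plus a block triangular map whose diagonal part has Lipschitz constant
    at most 1/2: al (rho + r^2 / 3 + 3 r^2) <= 11/30. Both the forward bound and the inverse bound
    follow from this form. *)
Lemma step_diff X Y (i : 'I_p) : col_box X -> col_box Y ->
  enorm (col i (step X) - col i (step Y) - (col i X - col i Y)) <=
  1 / 2 * enorm (col i X - col i Y) +
  \sum_(j < p | (j < i)%N) enorm (col j X - col j Y).
Proof.
move=> bX bY; rewrite !col_step; set x := col i X; set y := col i Y.
have al0 := alpha_gt0; have r0 := rho_gt0.
have r00 : 0 <= r := col_radius_ge0 p.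
have Xr (j : 'I_p) : enorm (col j X) <= r := le_trans (bX j) (col_radius_le (ltn_ord j)).
have Yr (j : 'I_p) : enorm (col j Y) <= r := le_trans (bY j) (col_radius_le (ltn_ord j)).
have r2 : col_radius rho i.+1 ^+ 2 <= r ^+ 2.
  by rewrite lerXn2r ?nnegrE ?col_radius_ge0 // col_radius_le.
have rhor : 3 * rho <= r ^+ 2 := le_trans (rho_le_radius i) r2.
set S := \sum_(j < p | _) _.
have S0 : 0 <= S by apply: sumr_ge0 => j _; exact: enorm_ge0.
have -> : x - alpha *: (deflated A X i x + enorm x ^+ 2 *: x) -
    (y - alpha *: (deflated A Y i y + enorm y ^+ 2 *: y)) - (x - y) =
    - (alpha *: (deflated A X i (x - y) + (deflated A X i y - deflated A Y i y)
       + (enorm x ^+ 2 *: x - enorm y ^+ 2 *: y))).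
  by rewrite deflatedB; apply/matrixP=> k o; rewrite !mxE; ring.
rewrite enormN enormZ gtr0_norm //.
have d0 := enorm_ge0 (x - y).
have h1 : enorm (deflated A X i (x - y)) <= (rho + r ^+ 2 / 3) * enorm (x - y).
  apply: le_trans (enormD _ _) _; rewrite mulrDl; apply: lerD.
    exact: spectral_norm_le.
  apply: le_trans (enorm_sum _ _ _) _.
  apply: (@le_trans _ _ (\sum_(j < p | (j < i)%N) enorm (col j X) ^+ 2 * enorm (x - y))).
    apply: ler_sum => j _; rewrite enormZ expr2 mulrAC.
    by apply: ler_wpM2r; [exact: enorm_ge0|exact: dotv_cauchy].
  rewrite -mulr_suml; apply: ler_wpM2r => //.
  by apply: le_trans (sum_sqr_radius i bX) _; lra.
have h2 : enorm (deflated A X i y - deflated A Y i y) <= 2 * r * S * r.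
  apply: le_trans (deflated_diff A y (fun j _ => Xr j) (fun j _ => Yr j)) _.
  by apply: ler_wpM2l; [rewrite !mulr_ge0|exact: Yr].
have h3 := cube_diff_le (Xr i) (Yr i); rewrite -/x -/y in h3.
have h4 := enormD (deflated A X i (x - y) + (deflated A X i y - deflated A Y i y))
  (enorm x ^+ 2 *: x - enorm y ^+ 2 *: y).
have h5 := enormD (deflated A X i (x - y)) (deflated A X i y - deflated A Y i y).
apply: (@le_trans _ _ (alpha * ((rho + r ^+ 2 / 3) * enorm (x - y) + 2 * r * S * r
   + 3 * r ^+ 2 * enorm (x - y)))); first by rewrite ler_pM2l //; lra.
have k1 : alpha * r ^+ 2 * S <= 1 / 10 * S by apply: ler_wpM2r.
have k2 : alpha * r ^+ 2 * enorm (x - y) <= 1 / 10 * enorm (x - y) by apply: ler_wpM2r.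
have k3 : alpha * (3 * rho) * enorm (x - y) <= alpha * r ^+ 2 * enorm (x - y).
  by apply: ler_wpM2r => //; rewrite ler_pM2l.
lra.
Qed.

(** Stated for initial blocks of columns: if the predecessors of column i start close, they stay
    close over a fixed horizon whatever column i does. *)
Lemma step_lipschitz X Y i : col_box X -> col_box Y ->
  \sum_(j < p | (j < i)%N) enorm (col j (step X) - col j (step Y)) <=
  (p%:R + 2) * \sum_(j < p | (j < i)%N) enorm (col j X - col j Y).
Proof.
move=> bX bY; set S := \sum_(j < p | (j < i)%N) enorm (col j X - col j Y).
apply: (@le_trans _ _ (\sum_(j < p | (j < i)%N)
   (2 * enorm (col j X - col j Y) + S))).
  apply: ler_sum => j ji.
  have h1 := step_diff j bX bY.
  have h2 := enormB_ge (col j (step X) - col j (step Y)) (col j X - col j Y).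
  have h3 : \sum_(k < p | (k < j)%N) enorm (col k X - col k Y) <= S.
    rewrite /S [leRHS](bigID (fun k : 'I_p => (k < j)%N)) /=.
    have -> : \sum_(k < p | (k < i)%N && (k < j)%N) enorm (col k X - col k Y) =
        \sum_(k < p | (k < j)%N) enorm (col k X - col k Y).
      by apply: eq_bigl => k; case: (ltnP k j) => kj; rewrite ?andbT ?andbF // (ltn_trans kj ji).
    by rewrite lerDl; apply: sumr_ge0 => k _; exact: enorm_ge0.
  have h4 := enorm_ge0 (col j X - col j Y).
  lra.
rewrite big_split /= -mulr_sumr -/S [leRHS]mulrDl addrC lerD2r.
rewrite big_const iter_addr_0 -[leRHS]mulrC mulr_natr; apply: ler_wpMn2l.
  by apply: sumr_ge0 => j _; exact: enorm_ge0.
by rewrite -[leqRHS]card_ord; exact: max_card.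
Qed.

(** Forward substitution: |d_i| <= 2 (m + sum_(j < i) |d_j|), and 2 * 3^i m solves this recursion
    with equality, since sum_(j < i) 2 * 3^j = 3^i - 1. *)
Lemma step_inverse X Y m : col_box X -> col_box Y -> 0 <= m ->
  (forall i, enorm (col i (step X) - col i (step Y)) <= m) ->
  forall i, enorm (col i X - col i Y) <= 2 * 3 ^+ p * m.
Proof.
move=> bX bY m0 hm.
have main k (i : 'I_p) : i = k :> nat -> enorm (col i X - col i Y) <= 2 * 3 ^+ k * m.
  elim/ltn_ind: k i => k IH i ik.
  have h1 := step_diff i bX bY; have h2 := hm i.
  have h3 := enormB_ge (col i X - col i Y) (col i (step X) - col i (step Y)).
  rewrite (enorm_subC (col i X - col i Y)) in h3.
  have h4 : \sum_(j < p | (j < i)%N) enorm (col j X - col j Y) <= (3 ^+ k - 1) * m.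
    apply: (@le_trans _ _ (\sum_(j < p | (j < i)%N) 2 * 3 ^+ j * m)).
      by apply: ler_sum => j ji; apply: IH => //; rewrite -ik.
    rewrite -(big_ord_widen _ (fun j => 2 * 3 ^+ j * m)) 1?ltnW // ik.
    elim: k {IH ik} => [|k IH]; first by rewrite big_ord0 expr0 subrr mul0r.
    by rewrite big_ord_recr /= exprS; lra.
  lra.
move=> i; apply: le_trans (main i i erefl) _; apply: ler_wpM2r => //.
by apply: ler_wpM2l => //; apply: ler_weXn2l; rewrite ?ler1n // ltnW.
Qed.

Lemma box_iterate X t : col_box X -> col_box (iterate A alpha X t).
Proof. by move=> bX; elim: t => [//|t IH]; rewrite /iterate iterS; exact: box_invariant. Qed.

Lemma iterate_lipschitz X Y i t : col_box X -> col_box Y ->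
  \sum_(j < p | (j < i)%N) enorm (col j (iterate A alpha X t) - col j (iterate A alpha Y t))
  <= (p%:R + 2) ^+ t * \sum_(j < p | (j < i)%N) enorm (col j X - col j Y).
Proof.
move=> bX bY; elim: t => [|t IH]; first by rewrite expr0 mul1r.
rewrite {1 2}/iterate !iterS -!/(iterate _ _ _ _).
apply: le_trans (step_lipschitz _ (box_iterate t bX) (box_iterate t bY)) _.
by rewrite exprS -mulrA; apply: ler_wpM2l.
Qed.

Lemma cube_null_iterate S t : cube_null S ->
  cube_null [set X | col_box X /\ S (iterate A alpha X t)].
Proof.
elim: t S => [|t IH] S hS; first by apply: cube_null_sub hS => X [].
(* The factor n passes from entrywise bounds, which define cubes, to Euclidean norms of columns. *)
apply: (@cube_null_preimage _ _ _ step (2 * 3 ^+ p * n%:R)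
   [set X | col_box X /\ S (iterate A alpha X t)]).
- by rewrite !mulr_ge0 ?exprn_ge0.
- exact: IH.
- move=> X [bX SX]; split; first exact: box_invariant.
  by rewrite /iterate -iterSr.
move=> X Y B [bX _] [bY _] hB k i.
have B0 : 0 <= B by apply: le_trans (hB k i).
have := @step_inverse X Y (n%:R * B) bX bY (mulr_ge0 (ler0n _ _) B0) _ i.
rewrite mulrA => h; apply: le_trans (h _).
  by have := enorm_coord (col i X - col i Y) k; rewrite !mxE.
move=> j; apply: le_trans (enorm_le_sum _) _.
apply: (@le_trans _ _ (\sum_(l < n) B)).
  by apply: ler_sum => l _; have := hB l j; rewrite !mxE.
by rewrite big_const iter_addr_0 card_ord mulr_natl.
Qed.

End Box.

(** * Eigenbases *)

(** The point of X* with all signs +1. Nothing is lost, because V ranges over all eigenbases and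
    changing the sign of a column gives another one. *)
Definition ideal (R : realType) n p (hpn : (p <= n)%N) (lam : 'I_n -> R) (V : 'M[R]_n)
  : 'M[R]_(n, p) := first_cols hpn V *m map_mx Num.sqrt (- first_eigs hpn lam).

(* Spectrum of A + sum_(j < i) x_j x_j^T at an ideal configuration. *)
Definition deflated_eig (R : realType) n (lam : 'I_n -> R) (i : nat) (k : 'I_n) : R :=
  if (k < i)%N then 0 else lam k.

(** Indexes the lowest eigenspace of the operator deflated by the first columns: earlier indices are
    left out even when their eigenvalue equals [lam i], because deflation has moved them to 0. *)
Definition level (R : realType) n (lam : 'I_n -> R) (i : 'I_n) : pred 'I_n :=
  fun k => (i <= k)%N && (lam k == lam i).

Lemma tr_mulmx_entry (R : realType) n m q (U : 'M[R]_(n, m)) (V : 'M[R]_(n, q)) i j :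
  (U^T *m V) i j = dotv (col i U) (col j V).
Proof. by rewrite mxE; apply: eq_bigr => k _; rewrite !mxE. Qed.

Lemma tr_mulcv_entry (R : realType) n m (U : 'M[R]_(n, m)) (x : 'cV[R]_n) i :
  (U^T *m x) i 0 = dotv (col i U) x.
Proof. by rewrite tr_mulmx_entry; congr dotv; apply/matrixP=> k o; rewrite !mxE ord1. Qed.

Lemma widen_ord_injective m n (h : (m <= n)%N) : injective (widen_ord h).
Proof. by move=> a b /(congr1 val) /= /val_inj. Qed.

Section Eigenbasis.
Context {R : realType} {n : nat}.
Variables (A : 'M[R]_n) (lam : 'I_n -> R).
Hypothesis symA : A^T = A.
Implicit Types (V : 'M[R]_n) (x y z : 'cV[R]_n).

Lemma eigenbasis_dotv V k l : ordered_eigenbasis A lam V ->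
  dotv (col k V) (col l V) = (k == l)%:R.
Proof. by case=> _ oV _; rewrite -tr_mulmx_entry oV mxE. Qed.

Lemma eigenbasis_enorm V k : ordered_eigenbasis A lam V -> enorm (col k V) = 1.
Proof.
move=> hV; apply/eqP; rewrite -(@eqrXn2 _ 2) ?enorm_ge0 //.
by rewrite enormE (eigenbasis_dotv _ _ hV) eqxx expr1n.
Qed.

Lemma eigenbasis_trK V x : ordered_eigenbasis A lam V -> V *m (V^T *m x) = x.
Proof. by case=> _ oV _; rewrite mulmxA (mulmx1C oV) mul1mx. Qed.

Lemma eigenbasis_enorm_tr V x : ordered_eigenbasis A lam V -> enorm (V^T *m x) = enorm x.
Proof. by case=> _ oV _; apply: enorm_orth; rewrite trmxK (mulmx1C oV). Qed.

Lemma dotv_sym x y : dotv x (A *m y) = dotv (A *m x) y.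
Proof. by rewrite dotv_mulmx symA. Qed.

Lemma eigenbasis_mulmx V x k : ordered_eigenbasis A lam V ->
  (V^T *m (A *m x)) k 0 = lam k * (V^T *m x) k 0.
Proof. by case=> _ _ hV; rewrite !tr_mulcv_entry dotv_sym hV dotvZl. Qed.

Lemma eigenvalue_le V k : ordered_eigenbasis A lam V -> `|lam k| <= spectral_norm A.
Proof.
move=> hV; have := spectral_norm_le A (col k V); have [_ _ ->] := hV.
by rewrite enormZ (eigenbasis_enorm _ hV) !mulr1.
Qed.

(* The Householder reflection exchanging [col i V] and [z]: it commutes with A
   because both vectors lie in one eigenspace. *)
Lemma eigenbasis_exchange V (i : 'I_n) z : ordered_eigenbasis A lam V ->
  mask (level lam i) (V^T *m z) = V^T *m z -> enorm z = 1 ->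
  exists V', [/\ ordered_eigenbasis A lam V', col i V' = z
    & forall j : 'I_n, (j < i)%N -> col j V' = col j V].
Proof.
move=> hV Kz z1; have [ord oV eV] := hV.
have [vz|vz] := eqVneq (col i V) z; first by exists V.
set u := col i V - z.
have zK k : ~~ level lam i k -> dotv (col k V) z = 0.
  move=> nk; rewrite -tr_mulcv_entry -Kz mxE; by rewrite (negPf nk).
have uK k : ~~ level lam i k -> dotv u (col k V) = 0.
  move=> nk; rewrite dotvC dotvDr dotvNr zK // (eigenbasis_dotv _ _ hV) subr0.
  by case: eqP nk => // ->; rewrite /level leqnn eqxx.
set b := dotv (col i V) z.
have ui : dotv u (col i V) = 1 - b.
  by rewrite dotvDl dotvNl (eigenbasis_dotv _ _ hV) eqxx (dotvC z).
have uu : dotv u u = 2 * (1 - b).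
  rewrite {2}/u dotvDr dotvNr ui dotvDl dotvNl -/b -(enormE z) z1 expr1n; ring.
have b1 : 1 - b != 0.
  apply: contraNneq vz => b0; rewrite -subr_eq0 -/u; apply/eqP/enorm_eq0/eqP.
  by rewrite -sqrf_eq0 enormE uu b0 mulr0.
have lu : A *m u = lam i *: u.
  rewrite -[LHS](eigenbasis_trK _ hV) -[in RHS](eigenbasis_trK u hV) scalemxAr.
  congr (V *m _); apply/matrixP=> k o; rewrite ord1 [RHS]mxE (eigenbasis_mulmx _ _ hV).
  have [/andP[_ /eqP ->] //|nk] := boolP (level lam i k).
  by rewrite !tr_mulcv_entry (dotvC _ u) uK // !mulr0.
have uz : col i V - u = z by rewrite /u opprB addrC subrK.
clearbody u.
(* The Householder coefficient 2 (u . v) / (u . u), by [uu]. *)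
pose c k := dotv u (col k V) / (1 - b).
pose V' := \matrix_(k, l) (V k l - c l * u k 0).
have cV l : col l V' = col l V - c l *: u.
  by apply/matrixP=> k o; rewrite ord1 !mxE.
exists V'; split.
- split=> //.
    apply/matrixP=> k l; rewrite tr_mulmx_entry !cV [RHS]mxE -(eigenbasis_dotv k l hV).
    rewrite !dotvE uu (dotvC (col k V) u) /c; field.
    exact: b1.
  move=> k; rewrite cV mulmxBr eV -scalemxAr lu scalerBr; congr (_ - _).
  have [/andP[_ /eqP ->]|nk] := boolP (level lam i k).
    by rewrite !scalerA mulrC.
  by rewrite /c uK // mul0r !scale0r scaler0.
- by rewrite cV /c ui divff // scale1r.
- move=> j ji; rewrite cV /c uK ?mul0r ?scale0r ?subr0 //.
  by rewrite /level leqNgt ji.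
Qed.

End Eigenbasis.

Section Coordinates.
Context {R : realType} {n p : nat}.
Variables (hpn : (p <= n)%N) (A : 'M[R]_n) (lam : 'I_n -> R) (alpha : R).
Hypotheses (symA : A^T = A) (p_neg : (p <= num_neg lam)%N).
Local Notation rho := (spectral_norm A).
Local Notation r := (col_radius rho p).
Local Notation w := (widen_ord hpn).
Implicit Types (V : 'M[R]_n) (X : 'M[R]_(n, p)).

Lemma ideal_col V j : col j (ideal hpn lam V) = Num.sqrt (- lam (w j)) *: col (w j) V.
Proof.
apply/matrixP=> k o; rewrite ord1 !mxE (bigD1 j) //= big1 ?addr0 => [|l lj].
  by rewrite !mxE eqxx mulr1n mulrC.
by rewrite !mxE (negPf lj) mulr0n oppr0 sqrtr0 mulr0.
Qed.

Lemma eig_lt0 V (j : 'I_p) : ordered_eigenbasis A lam V -> lam (w j) < 0.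
Proof.
move=> [ord _ _]; rewrite ltNge; apply/negP => l0.
have : (num_neg lam <= j)%N.
  have jn : (j < n)%N := leq_trans (ltn_ord j) hpn.
  rewrite /num_neg -[leqRHS](card_ord j) -(fintype.card_image (@widen_ord_injective _ _ (ltnW jn))).
  apply/subset_leq_card/fintype.subsetP => k; rewrite inE => k0; apply/fintype.imageP.
  have kj : (k < j)%N.
    rewrite ltnNge; apply/negP => /(ord (w j) k) /(le_trans l0).
    by rewrite leNgt k0.
  by exists (Ordinal kj) => //; apply/val_inj.
by rewrite leqNgt (leq_trans (ltn_ord j) p_neg).
Qed.

(** An ideal column has squared norm -lam_j, so its rank-one term cancels eigenvalue j exactly; the
    lowest eigenvalue left is the next one. *)
Lemma deflated_ideal V i x : (i <= p)%N -> ordered_eigenbasis A lam V ->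
  V^T *m deflated A (ideal hpn lam V) i x = dscale (deflated_eig lam i) (V^T *m x).
Proof.
move=> ip hV; apply/matrixP=> k o; rewrite ord1 mulmxDr [LHS]mxE [RHS]mxE /deflated_eig.
rewrite (eigenbasis_mulmx symA _ _ hV).
rewrite !tr_mulcv_entry dotv_sumr.
have E (j : 'I_p) : dotv (col k V) (dotv (col j (ideal hpn lam V)) x *: col j (ideal hpn lam V))
    = - lam (w j) * (k == w j)%:R * dotv (col (w j) V) x.
  rewrite ideal_col dotvZl !dotvZr (eigenbasis_dotv _ _ hV).
  have s2 : Num.sqrt (- lam (w j)) ^+ 2 = - lam (w j).
    by rewrite sqr_sqrtr // oppr_ge0 ltW // (eig_lt0 _ hV).
  by set s := Num.sqrt _ in s2 *; rewrite -s2; ring.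
under eq_bigr do rewrite E.
case: ltnP => ki.
  have kp : (k < p)%N := leq_trans ki ip.
  have wk : w (Ordinal kp) = k by apply/val_inj.
  rewrite (bigD1 (Ordinal kp)) //= big1 => [|j /andP[_ jk]].
    by rewrite wk eqxx mulr1; ring.
  by rewrite eq_sym -wk (inj_eq (@widen_ord_injective _ _ hpn)) (negPf jk) mulr0 mul0r.
rewrite big1 ?addr0 // => j ji; case: eqP => [kj|_]; last by rewrite mulr0 mul0r.
by move: ki; rewrite kj /= leqNgt ji.
Qed.

Lemma spectral_gt0 V (j : 'I_p) : ordered_eigenbasis A lam V -> 0 < rho.
Proof.
move=> hV; have := eigenvalue_le (w j) hV; apply: lt_le_trans.
by rewrite normr_gt0 lt_eqF // (eig_lt0 _ hV).
Qed.

Lemma ideal_radius V (j : 'I_p) : ordered_eigenbasis A lam V ->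
  enorm (col j (ideal hpn lam V)) <= r.
Proof.
move=> hV; have rho0 := spectral_gt0 j hV.
rewrite ideal_col enormZ (eigenbasis_enorm _ hV) mulr1 ger0_norm ?sqrtr_ge0 //.
apply: le_trans (col_radius_le A (ltn_ord j)).
rewrite -(@ler_pXn2r _ 2) ?nnegrE ?sqrtr_ge0 ?col_radius_ge0 //.
rewrite sqr_sqrtr; last by rewrite oppr_ge0 ltW // (eig_lt0 _ hV).
apply: le_trans (rho_le_radius rho0 j).
have := eigenvalue_le (w j) hV; rewrite ltr0_norm ?(eig_lt0 _ hV) //; lra.
Qed.

Definition lag V X (i : nat) : R :=
  \sum_(j < p | (j < i)%N) enorm (col j X - col j (ideal hpn lam V)).

Definition defect V X (i : 'I_p) : 'cV[R]_n :=
  V^T *m deflated A X i (col i X) - dscale (deflated_eig lam i) (V^T *m col i X).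

Lemma lag_ge0 V X i : 0 <= lag V X i.
Proof. by apply: sumr_ge0 => j _; exact: enorm_ge0. Qed.

Lemma col_step_coord V X i : ordered_eigenbasis A lam V ->
  V^T *m col i (X - alpha *: g A X) =
  col_next (deflated_eig lam i) alpha (V^T *m col i X) (defect V X i).
Proof.
move=> hV; rewrite col_step /col_next (eigenbasis_enorm_tr _ hV) /defect.
rewrite mulmxBr -scalemxAr mulmxDr -scalemxAr.
by apply/matrixP=> k o; rewrite !mxE; ring.
Qed.

(** The error is relative to |x|. This matters because a column may come arbitrarily close to 0,
    where an absolute error would dominate. *)
Lemma deflated_defect V X (i : 'I_p) x : ordered_eigenbasis A lam V ->
  (forall j, enorm (col j X) <= r) ->
  enorm (V^T *m deflated A X i x - dscale (deflated_eig lam i) (V^T *m x)) <=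
  2 * r * lag V X i * enorm x.
Proof.
move=> hV Xr; rewrite -(deflated_ideal _ (ltnW (ltn_ord i)) hV) -mulmxBr.
rewrite (eigenbasis_enorm_tr _ hV); apply: deflated_diff => j _; first exact: Xr.
exact: ideal_radius.
Qed.

Lemma eigen_gap V (i : 'I_p) : ordered_eigenbasis A lam V ->
  exists gam : R, [/\ 0 < gam, lam (w i) + gam <= 0 &
    forall k, ~~ level lam (w i) k -> lam (w i) + gam <= deflated_eig lam i k].
Proof.
move=> hV; have [ord _ _] := hV; have l0 := eig_lt0 i hV.
pose f k := if level lam (w i) k then - lam (w i) else deflated_eig lam i k - lam (w i).
have f0 k : 0 < f k.
  rewrite /f /level /deflated_eig; case: ifP => [_|]; first by rewrite oppr_gt0.
  case: ltnP => [ki _|ik /= /negbT lk]; first by rewrite sub0r oppr_gt0.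
  by rewrite subr_gt0 lt_neqAle eq_sym lk ord.
(* The default -lam_i also enforces lam_i + gam <= 0; indices in the level get the same harmless
   value. *)
exists (\big[Num.min/- lam (w i)]_k f k); split.
- by elim/big_ind: _ => [|a b a0 b0|//]; [rewrite oppr_gt0|rewrite lt_min a0].
- have : \big[Num.min/- lam (w i)]_k f k <= - lam (w i).
    elim/big_rec: _ => // k y _ h; rewrite ge_min h orbT //.
  lra.
move=> k nk; have : \big[Num.min/- lam (w i)]_k f k <= f k.
  by rewrite (bigD1 k) //= ge_min lexx.
by rewrite {2}/f (negPf nk); lra.
Qed.

End Coordinates.

(** * The exceptional sets *)

(** Grid points need not lie in [S], so each grid cell meeting [S] is represented by one of its own
    points; [V0] fills the other cells. *)
Lemma countable_net (R : realType) n m (S : set 'M[R]_(n, m)) (del : R) :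
  S !=set0 -> 0 < del -> exists F : 'M[int]_(n, m) -> 'M[R]_(n, m),
    (forall M, S (F M)) /\ forall V, S V -> exists M, forall k l, `|V k l - F M k l| <= del.
Proof.
move=> [V0 SV0] del0.
pose near (V : 'M[R]_(n, m)) (M : 'M[int]_(n, m)) :=
  forall k l, `|V k l - del / 2 * (M k l)%:~R| <= del / 2.
have /choice[F hF] M : exists V', S V' /\ forall V, S V -> near V M -> near V' M.
  have [[V [SV nV]]|no] := pselect (exists V, S V /\ near V M); first by exists V.
  by exists V0; split=> // V SV nV; case: no; exists V.
exists F; split=> [M|V SV]; first exact: (hF M).1.
have del20 : 0 < del / 2 by rewrite divr_gt0.
pose M : 'M[int]_(n, m) := \matrix_(k, l) Num.floor (V k l / (del / 2)).
have nV : near V M.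
  move=> k l; rewrite mxE; have := floor_itv (V k l / (del / 2)).
  rewrite intrD ler_pdivlMr // ltr_pdivrMr // => /andP[h1 h2].
  by rewrite ler_norml; apply/andP; split; lra.
exists M => k l; have := nV k l; have := (hF M).2 V SV nV k l.
by rewrite !ler_norml => /andP[? ?] /andP[? ?]; apply/andP; split; lra.
Qed.

Lemma iterateD (R : realType) n p (A : 'M[R]_n) alpha (X : 'M[R]_(n, p)) s t :
  iterate A alpha (iterate A alpha X s) t = iterate A alpha X (s + t).
Proof. by rewrite /iterate -iterD addnC. Qed.

Section Exceptional.
Context {R : realType} {n p : nat}.
Variables (hpn : (p <= n)%N) (A : 'M[R]_n) (lam : 'I_n -> R) (alpha : R).
Local Notation rho := (spectral_norm A).
Local Notation r := (col_radius rho p).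
Local Notation w := (widen_ord hpn).
Local Notation "X ^[ t ]" := (iterate A alpha X t) (at level 2, format "X ^[ t ]").
Local Notation P i := (mask (level lam (w i))).
Local Notation Q i := (mask (predC (level lam (w i)))).
Hypotheses (symA : A^T = A) (p_neg : (p <= num_neg lam)%N).
Hypotheses (alpha_gt0 : 0 < alpha) (alpha_r : alpha * r ^+ 2 <= 1 / 10).
Implicit Types (V : 'M[R]_n) (X Y : 'M[R]_(n, p)).

(** The late time is shifted to 0. [V] will come from a countable net and need not be the limiting
    basis, so the lag is only asked to be small, not to tend to 0. *)
Definition exceptional V (eta : R) (i : 'I_p) : set 'M[R]_(n, p) :=
  [set X | col_box A X /\ forall t,
    2 * r * lag hpn lam V X^[t] i <= eta /\
    enorm (P i (V^T *m col i X^[t])) <= eta * enorm (Q i (V^T *m col i X^[t]))].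

Definition tracks V X (i : nat) : Prop := forall j : 'I_p, (j < i)%N ->
  expdec (fun t => enorm (col j X^[t] - col j (ideal hpn lam V))).

Lemma level_deflated (i : 'I_p) k : level lam (w i) k -> deflated_eig lam i k = lam (w i).
Proof. by rewrite /level /deflated_eig => /andP[/= ik /eqP ->]; rewrite ltnNge ik. Qed.

Lemma deflated_window V (i : 'I_p) (gam : R) : ordered_eigenbasis A lam V -> 0 < gam ->
  (forall k, ~~ level lam (w i) k -> lam (w i) + gam <= deflated_eig lam i k) ->
  forall k, ~~ level lam (w i) k ->
    lam (w i) + gam <= deflated_eig lam i k <= lam (w i) + gam + r ^+ 2.
Proof.
move=> hV gam0 h k nk; rewrite h //=.
have rho0 := spectral_gt0 hpn p_neg i hV.
have r2 : col_radius rho i.+1 ^+ 2 <= r ^+ 2.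
  by rewrite lerXn2r ?nnegrE ?col_radius_ge0 // col_radius_le.
have r3 := rho_le_radius rho0 i.
have := eigenvalue_le (w i) hV; have := eigenvalue_le k hV.
rewrite !ler_norml => /andP[? ?] /andP[? ?].
by rewrite /deflated_eig; case: ifP => _; lra.
Qed.

Lemma eig_ge_radius V (i : 'I_p) : ordered_eigenbasis A lam V -> - r ^+ 2 <= lam (w i).
Proof.
move=> hV; have rho0 := spectral_gt0 hpn p_neg i hV.
have r2 : col_radius rho i.+1 ^+ 2 <= r ^+ 2.
  by rewrite lerXn2r ?nnegrE ?col_radius_ge0 // col_radius_le.
have r3 := rho_le_radius rho0 i.
have := eigenvalue_le (w i) hV; rewrite ler_norml => /andP[? ?]; lra.
Qed.

Lemma col_box_radius X (j : 'I_p) : col_box A X -> enorm (col j X) <= r.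
Proof. by move=> bX; apply: le_trans (bX j) (col_radius_le A (ltn_ord j)). Qed.

Lemma iterate_coord V X i t : ordered_eigenbasis A lam V ->
  V^T *m col i X^[t.+1] = col_next (deflated_eig lam i) alpha (V^T *m col i X^[t])
     (defect A lam V X^[t] i) :> 'cV[R]_n.
Proof. by move=> hV; rewrite -(col_step_coord alpha X^[t] i hV). Qed.

(** Selects the matrix entry over which the exceptional set is a graph: moving along it changes the
    component on eigenvector i by at least 1/n of the move. *)
Lemma eigenbasis_large_entry V (i : 'I_n) : ordered_eigenbasis A lam V ->
  exists l, 1 / n%:R <= `|V l i|.
Proof.
move=> hV; have n0 : 0 < n%:R :> R.
  by rewrite ltr0n; apply: leq_ltn_trans (ltn_ord i).
have [//|no] := pselect (exists l, 1 / n%:R <= `|V l i|).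
have small l : `|V l i| < 1 / n%:R.
  by rewrite ltNge; apply/negP => h; apply: no; exists l.
have : \sum_(l < n) `|V l i| < \sum_(l < n) (1 / n%:R).
  apply: ltr_sum; first by apply/hasP; exists i; rewrite ?mem_index_enum.
  by move=> l _; exact: small.
have -> : \sum_(l < n) (1 / n%:R) = 1 :> R.
  by rewrite big_const iter_addr_0 card_ord -[LHS]mulr_natr divfK ?gt_eqF.
have := enorm_le_sum (col i V); rewrite (eigenbasis_enorm _ hV).
under eq_bigr do rewrite mxE.
by rewrite leNgt => /negP.
Qed.

(** The first term is the relative error of [pair_separation]; the second, due to slightly different
    predecessors, becomes its [tau]. *)
Lemma defect_diff V X Y (i : 'I_p) (eta : R) : ordered_eigenbasis A lam V ->
  col_box A X -> col_box A Y -> 2 * r * lag hpn lam V X i <= eta ->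
  enorm (defect A lam V X i - defect A lam V Y i) <=
  eta * enorm (V^T *m col i X - V^T *m col i Y) +
  2 * r ^+ 2 * \sum_(j < p | (j < i)%N) enorm (col j X - col j Y).
Proof.
move=> hV bX bY hX; rewrite -mulmxBr (eigenbasis_enorm_tr _ hV).
set x := col i X; set y := col i Y.
have -> : defect A lam V X i - defect A lam V Y i =
   (V^T *m deflated A X i (x - y) - dscale (deflated_eig lam i) (V^T *m (x - y))) +
   V^T *m (deflated A X i y - deflated A Y i y).
  rewrite /defect deflatedB !mulmxBr -/x -/y.
  have -> : dscale (deflated_eig lam i) (V^T *m x - V^T *m y) =
     dscale (deflated_eig lam i) (V^T *m x) - dscale (deflated_eig lam i) (V^T *m y).
    by apply/matrixP=> k o; rewrite ord1 !mxE; ring.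
  move: (V^T *m deflated A X i x) (V^T *m deflated A X i y) (V^T *m deflated A Y i y) => a b c.
  move: (dscale _ (V^T *m x)) (dscale _ (V^T *m y)) => dx dy.
  by apply/matrixP=> k o; rewrite !mxE; ring.
apply: le_trans (enormD _ _) _; apply: lerD.
  apply: le_trans (deflated_defect hpn symA p_neg i _ hV (fun j => col_box_radius j bX)) _.
  by apply: ler_wpM2r => //; exact: enorm_ge0.
rewrite (eigenbasis_enorm_tr _ hV).
apply: le_trans (deflated_diff A y (fun j _ => col_box_radius j bX)
  (fun j _ => col_box_radius j bY)) _.
have S0 : 0 <= \sum_(j < p | (j < i)%N) enorm (col j X - col j Y).
  by apply: sumr_ge0 => j _; exact: enorm_ge0.
have : 2 * r * (\sum_(j < p | (j < i)%N) enorm (col j X - col j Y)) * enorm y <=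
   2 * r * (\sum_(j < p | (j < i)%N) enorm (col j X - col j Y)) * r.
  apply: ler_wpM2l; last exact: col_box_radius.
  by rewrite !mulr_ge0 // col_radius_ge0.
by move/le_trans; apply; rewrite expr2; lra.
Qed.

(** If two points differ by s in the selected entry and negligibly elsewhere, then |d| <= 2 |s| and
    |P d| >= |s| / (2 n); this places d in the cone of aperture [kc] = 4 n. Separation then bounds
    |s|, giving the modulus of continuity of the graph. *)
Lemma exceptional_null V (eta gam : R) (i : 'I_p) (kc := 4 * n%:R : R) :
  ordered_eigenbasis A lam V ->
  0 < gam -> lam (w i) + gam <= 0 ->
  (forall k, ~~ level lam (w i) k -> lam (w i) + gam <= deflated_eig lam i k) ->
  0 < eta -> eta <= 1 -> eta * kc <= 1 / 2 -> eta <= gam / 8 ->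
  2 * r ^+ 2 * eta * (1 + kc) + eta * (2 + kc) <= gam / 4 ->
  cube_null (exceptional V eta i).
Proof.
move=> hV gam0 lamgam gap eta0 eta1 etakc etag etar.
have rho0 := spectral_gt0 hpn p_neg i hV.
have r0 : 0 <= r := col_radius_ge0 A p.
have n1 : 1 <= n%:R :> R.
  by rewrite ler1n; apply: leq_ltn_trans (ltn_ord (w i)).
have n0 : 0 < n%:R :> R by lra.
have kc1 : 1 <= kc by rewrite /kc; lra.
have [l hl] := eigenbasis_large_entry (w i) hV.
apply: (@graph_cube_null _ _ _ _ l i r) => // [X [bX _] k j|e e0].
  by have := enorm_coord (col j X) k; rewrite mxE => /le_trans; apply; exact: col_box_radius.
have e2n : 0 < e / (2 * n%:R) by rewrite divr_gt0 // mulr_gt0.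
have [h [tau [tau0 sep]]] := @pair_separation _ n (deflated_eig lam i) (level lam (w i)) alpha
  (lam (w i)) gam r alpha_gt0 gam0 lamgam r0 alpha_r (eig_ge_radius i hV)
  (@level_deflated i) (deflated_window hV gam0 gap) eta kc _
  eta0 eta1 kc1 etakc etag etar e2n.
set B := 2 * r ^+ 2 * (p%:R + 2) ^+ h * (p%:R * n%:R) + 1.
have L1 : 1 <= p%:R + 2 :> R by have : 0 <= p%:R :> R by []; lra.
have B0 : 0 < B.
  by rewrite ltr_pwDr // !mulr_ge0 ?sqr_ge0 ?exprn_ge0 //; lra.
(* The first bound makes the other entries of column i negligible against s; the second keeps the
   predecessors' effect on the defect below [tau] throughout the horizon. *)
set del := Num.min (e / (2 * n%:R) / n%:R) (tau / B).
have del0 : 0 < del by rewrite lt_min !divr_gt0 // mulr_gt0.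
exists del => // X Y [bX hX] [bY hY] near; rewrite leNgt; apply/negP => se.
have ndel : n%:R * del <= e / (2 * n%:R).
  by rewrite mulrC -ler_pdivlMr // ge_min lexx.
have Bdel : B * del <= tau.
  by rewrite mulrC -ler_pdivlMr // ge_min lexx orbT.
set s := X l i - Y l i in se.
have colj (j : 'I_p) : (j < i)%N -> enorm (col j X - col j Y) <= n%:R * del.
  move=> ji; apply: le_trans (enorm_le_sum _) _.
  apply: (@le_trans _ _ (\sum_(k < n) del)); last first.
    by rewrite big_const iter_addr_0 card_ord mulr_natl.
  apply: ler_sum => k _; rewrite !mxE; apply: near.
  by apply/eqP => -[_ /(congr1 val) /= ji']; rewrite ji' ltnn in ji.
pose el : 'cV[R]_n := delta_mx l 0.
pose u := col i X - col i Y - s *: el.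
have un : enorm u <= n%:R * del.
  apply: le_trans (enorm_le_sum _) _.
  apply: (@le_trans _ _ (\sum_(k < n) del)); last first.
    by rewrite big_const iter_addr_0 card_ord mulr_natl.
  apply: ler_sum => k _; rewrite !mxE eqxx andbT.
  have [->|kl] := eqVneq k l; first by rewrite mulr1 subrr normr0 ltW.
  by rewrite mulr0 subr0; apply: near; rewrite xpair_eqE (negPf kl).
have dE : col i X - col i Y = s *: el + u by rewrite /u [RHS]addrC subrK.
have eln : enorm el <= 1.
  apply: enorm_le => //; rewrite /dotv (bigD1 l) //= !mxE !eqxx mulr1.
  by rewrite big1 ?addr0 ?expr1n // => k kl; rewrite !mxE (negPf kl) mul0r.
have VelE : (V^T *m el) (w i) 0 = V l (w i).
  rewrite mxE (bigD1 l) //= !mxE !eqxx mulr1 big1 ?addr0 // => k kl.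
  by rewrite !mxE (negPf kl) mulr0.
set x0 := V^T *m col i X; set y0 := V^T *m col i Y.
have xy : x0 - y0 = V^T *m (s *: el + u) by rewrite -dE mulmxBr.
have s0 : 0 < `|s| by apply: lt_trans se.
have snn : e / (2 * n%:R) < `|s| / (2 * n%:R) by rewrite ltr_pM2r ?invr_gt0 ?mulr_gt0.
have sn1 : `|s| / (2 * n%:R) <= `|s|.
  by rewrite ler_pdivrMr ?mulr_gt0 // ler_peMr ?ltW //; lra.
have Plo : `|s| / (2 * n%:R) <= enorm (P i (x0 - y0)).
  have := enorm_coord (P i (x0 - y0)) (w i).
  rewrite [P i _ _ _]mxE /level leqnn eqxx /= xy; apply: le_trans.
  have -> : (V^T *m (s *: el + u)) (w i) 0 = s * V l (w i) + (V^T *m u) (w i) 0.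
    by rewrite mulmxDr -scalemxAr [LHS]mxE [X in X + _ = _]mxE VelE.
  have h1 := enorm_coord (V^T *m u) (w i); rewrite (eigenbasis_enorm_tr _ hV) in h1.
  have h2 := lerB_normD (s * V l (w i)) ((V^T *m u) (w i) 0); rewrite normrM in h2.
  have h3 : `|s| * (1 / n%:R) <= `|s| * `|V l (w i)| by rewrite ler_pM2l.
  have h4 : `|s| * (1 / n%:R) = 2 * (`|s| / (2 * n%:R)) by field; rewrite gt_eqF.
  lra.
have Qhi : enorm (Q i (x0 - y0)) <= kc * enorm (P i (x0 - y0)).
  apply: le_trans (enorm_mask_le _ _) _; rewrite xy (eigenbasis_enorm_tr _ hV).
  apply: le_trans (enormD _ _) _; rewrite enormZ -xy.
  have h1 : `|s| * enorm el <= `|s| * 1 by rewrite ler_pM2l.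
  have h2 : kc * (`|s| / (2 * n%:R)) <= kc * enorm (P i (x0 - y0)).
    by apply: ler_wpM2l => //; lra.
  have h3 : kc * (`|s| / (2 * n%:R)) = 2 * `|s| by rewrite /kc; field; rewrite gt_eqF.
  lra.
have bXt t := box_iterate rho0 alpha_gt0 alpha_r t bX.
have bYt t := box_iterate rho0 alpha_gt0 alpha_r t bY.
have := sep (fun t => V^T *m col i X^[t]) (fun t => V^T *m col i Y^[t])
  (fun t => defect A lam V X^[t] i) (fun t => defect A lam V Y^[t] i)
  (fun t => iterate_coord X i t hV) (fun t => iterate_coord Y i t hV).
have bnd Z : col_box A Z -> enorm (V^T *m col i Z) <= r.
  by move=> bZ; rewrite (eigenbasis_enorm_tr _ hV) col_box_radius.
have dbnd Z : col_box A Z -> 2 * r * lag hpn lam V Z i <= eta ->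
    enorm (defect A lam V Z i) <= eta * enorm (V^T *m col i Z).
  move=> bZ hZ; rewrite (eigenbasis_enorm_tr _ hV).
  apply: le_trans (deflated_defect hpn symA p_neg i _ hV (fun j => col_box_radius j bZ)) _.
  by apply: ler_wpM2r => //; exact: enorm_ge0.
move=> /(_ (fun t => bnd _ (bXt t)) (fun t => bnd _ (bYt t))).
move=> /(_ (fun t => dbnd _ (bXt t) (hX t).1) (fun t => dbnd _ (bYt t) (hY t).1)).
move=> /(_ (fun t => (hX t).2) (fun t => (hY t).2)) sep'.
have : enorm (P i (x0 - y0)) < e / (2 * n%:R).
  apply: sep' => // t th.
  apply: le_trans (defect_diff hV (bXt t) (bYt t) (hX t).1) _; rewrite lerD2l.
  apply: le_trans Bdel; rewrite /B mulrDl mul1r.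
  set S := \sum_(j < p | _) _.
  have S1 : S <= (p%:R + 2) ^+ h * (p%:R * (n%:R * del)).
    apply: le_trans (iterate_lipschitz rho0 alpha_gt0 alpha_r i t bX bY) _.
    apply: ler_pM.
    - by rewrite exprn_ge0 //; lra.
    - by apply: sumr_ge0 => j _; exact: enorm_ge0.
    - by apply: ler_weXn2l => //; exact: ltnW.
    apply: (@le_trans _ _ (\sum_(j < p | (j < i)%N) (n%:R * del))).
      by apply: ler_sum => j ji; exact: colj.
    rewrite big_const iter_addr_0 [leRHS]mulr_natl; apply: ler_wpMn2l.
      by rewrite mulr_ge0 // ltW.
    by rewrite -[leqRHS]card_ord; exact: max_card.
  have : 2 * r ^+ 2 * S <= 2 * r ^+ 2 * ((p%:R + 2) ^+ h * (p%:R * (n%:R * del))).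
    by apply: ler_wpM2l => //; rewrite mulr_ge0 ?sqr_ge0.
  lra.
lra.
Qed.

End Exceptional.

(** * Induction on the columns *)

Section NextColumn.
Context {R : realType} {n p : nat}.
Variables (hpn : (p <= n)%N) (A : 'M[R]_n) (lam : 'I_n -> R) (alpha : R).
Local Notation rho := (spectral_norm A).
Local Notation r := (col_radius rho p).
Local Notation w := (widen_ord hpn).
Local Notation "X ^[ t ]" := (iterate A alpha X t) (at level 2, format "X ^[ t ]").
Local Notation P i := (mask (level lam (w i))).
Local Notation Q i := (mask (predC (level lam (w i)))).
Local Notation tracks := (tracks hpn A lam alpha).
Local Notation lag := (lag hpn lam).
Hypotheses (symA : A^T = A) (p_neg : (p <= num_neg lam)%N).
Hypotheses (alpha_gt0 : 0 < alpha) (alpha_r : alpha * r ^+ 2 <= 1 / 10).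
Implicit Types (V : 'M[R]_n) (X Y : 'M[R]_(n, p)).

Lemma tracks_lag V X i : tracks V X i -> expdec (fun t => lag V X^[t] i).
Proof. by move=> h; apply: expdec_sum => j ji; exact: h. Qed.

(** The limit found in V-coordinates is rescaled to a unit eigenvector and exchanged into the basis.
    Columns before i are untouched, so what was known about them carries over. *)
Lemma tracks_next V X (i : 'I_p) (gam Om : R) t0 :
  ordered_eigenbasis A lam V -> col_box A X -> tracks V X i ->
  0 < gam -> lam (w i) + gam <= 0 ->
  (forall k, ~~ level lam (w i) k -> lam (w i) + gam <= deflated_eig lam i k) ->
  1 <= Om ->
  (forall t, (t0 <= t)%N -> (1 + Om) * (2 * r * lag V X^[t] i) <= gam / 8) ->
  0 < enorm (P i (V^T *m col i X^[t0])) ->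
  enorm (Q i (V^T *m col i X^[t0])) <= Om * enorm (P i (V^T *m col i X^[t0])) ->
  exists V', ordered_eigenbasis A lam V' /\ tracks V' X i.+1.
Proof.
move=> hV bX trV gam0 lamgam gap Om1 small p0 q0.
have rho0 := spectral_gt0 hpn p_neg i hV.
have r0 : 0 <= r := col_radius_ge0 A p.
have bXt t := box_iterate rho0 alpha_gt0 alpha_r t bX.
have hlag := tracks_lag trV.
have [] := @good_column _ n (deflated_eig lam i) (level lam (w i)) alpha
  (lam (w i)) gam r alpha_gt0 gam0 lamgam r0 alpha_r (eig_ge_radius hpn p_neg i hV)
  (@level_deflated _ _ _ hpn lam i) (deflated_window p_neg hV gam0 gap)
  (fun t => V^T *m col i X^[t + t0]) (fun t => defect A lam V X^[t + t0] i)
  (fun t => 2 * r * lag V X^[t + t0] i) Om Om1.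
- by move=> t; exact: iterate_coord.
- by move=> t; rewrite (eigenbasis_enorm_tr _ hV) col_box_radius.
- move=> t; rewrite (eigenbasis_enorm_tr _ hV); apply: (deflated_defect hpn symA p_neg i _ hV) => j.
  exact: col_box_radius.
- apply: (expdec_le (M := 2 * r) (expdec_tail t0 hlag)) => t.
  by rewrite normrM (ger0_norm (mulr_ge0 (ler0n _ 2) r0)).
- by move=> t; rewrite !mulr_ge0 ?lag_ge0.
- by move=> t; apply: small; exact: leq_addl.
- exact: p0.
- exact: q0.
move=> z [Kz zn hz]; have l0 := eig_lt0 hpn p_neg i hV.
set sig := Num.sqrt _ in zn.
have sig0 : 0 < sig by rewrite sqrtr_gt0 oppr_gt0.
have [_ oV _] := hV.
have VTz : V^T *m (sig^-1 *: (V *m z)) = sig^-1 *: z.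
  by rewrite -scalemxAr mulmxA oV mul1mx.
have [||V' [hV' Vi Vj]] := @eigenbasis_exchange _ _ A lam symA V (w i) (sig^-1 *: (V *m z)) hV.
- by rewrite VTz maskZ Kz.
- by rewrite enormZ (enorm_orth _ oV) zn gtr0_norm ?invr_gt0 // mulVf ?gt_eqF.
exists V'; split=> // j; rewrite ltnS leq_eqVlt => /predU1P[/val_inj ->|ji].
  apply: (@expdec_shift _ t0); apply: (eq_expdec hz) => t.
  rewrite ideal_col Vi scalerA divff ?gt_eqF // scale1r.
  rewrite -[in RHS](mul1mx z) -oV -mulmxA -mulmxBr.
  by rewrite (eigenbasis_enorm_tr _ hV).
apply: (eq_expdec (trV j ji)) => t.
by rewrite !ideal_col Vj.
Qed.

Lemma eigenbasis_close V V' (x : 'cV[R]_n) (del : R) :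
  (forall k l, `|V k l - V' k l| <= del) ->
  enorm (V^T *m x - V'^T *m x) <= n%:R * (n%:R * del) * enorm x.
Proof.
move=> h; apply: le_trans (enorm_le_sum _) _.
apply: (@le_trans _ _ (\sum_(k < n) n%:R * del * enorm x)); last first.
  by rewrite big_const iter_addr_0 card_ord -[leLHS]mulr_natl !mulrA.
apply: ler_sum => k _; rewrite -mulmxBl !mxE.
apply: le_trans (ler_norm_sum _ _ _) _.
apply: (@le_trans _ _ (\sum_(l < n) del * enorm x)); last first.
  by rewrite big_const iter_addr_0 card_ord -[leLHS]mulr_natl !mulrA.
apply: ler_sum => l _; rewrite normrM !mxE; apply: ler_pM => //.
exact: enorm_coord.
Qed.

Lemma lag_close V V' X i (del : R) : ordered_eigenbasis A lam V ->
  (forall k l, `|V k l - V' k l| <= del) -> 0 <= del ->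
  lag V' X i <= lag V X i + p%:R * (r * (n%:R * del)).
Proof.
move=> hV h del0; have r0 : 0 <= r := col_radius_ge0 A p.
have C0 : 0 <= r * (n%:R * del) by rewrite !mulr_ge0.
apply: (@le_trans _ _ (\sum_(j < p | (j < i)%N)
   (enorm (col j X - col j (ideal hpn lam V)) + r * (n%:R * del)))).
  apply: ler_sum => j _.
  have -> : col j X - col j (ideal hpn lam V') = (col j X - col j (ideal hpn lam V)) +
     Num.sqrt (- lam (w j)) *: (col (w j) V - col (w j) V').
    by rewrite !ideal_col scalerBr addrA subrK.
  apply: le_trans (enormD _ _) _; rewrite lerD2l enormZ.
  apply: ler_pM; rewrite ?enorm_ge0 //.
    have := ideal_radius hpn p_neg j hV; rewrite ideal_col enormZ.
    by rewrite (eigenbasis_enorm _ hV) mulr1.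
  apply: le_trans (enorm_le_sum _) _.
  apply: (@le_trans _ _ (\sum_(k < n) del)).
    by apply: ler_sum => k _; rewrite !mxE.
  by rewrite big_const iter_addr_0 card_ord mulr_natl.
rewrite big_split /= lerD2l big_const iter_addr_0 [leRHS]mulr_natl.
by apply: ler_wpMn2l => //; rewrite -[leqRHS]card_ord; exact: max_card.
Qed.

Lemma next_column_null U (i : 'I_p) : ordered_eigenbasis A lam U ->
  exists Z : set 'M[R]_(n, p), cube_null Z /\
    forall X, col_box A X -> ~ Z X ->
    (exists V, ordered_eigenbasis A lam V /\ tracks V X i) ->
    exists V, ordered_eigenbasis A lam V /\ tracks V X i.+1.
Proof.
move=> hU; have [gam [gam0 lamgam gap]] := eigen_gap hpn p_neg i hU.
have rho0 := spectral_gt0 hpn p_neg i hU.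
have r0 : 0 <= r := col_radius_ge0 A p.
have p0 : (0 < p)%N by apply: leq_ltn_trans (ltn_ord i).
have n1 : 1 <= n%:R :> R by rewrite ler1n; exact: leq_trans hpn.
set kc : R := 4 * n%:R; have kc4 : 4 <= kc by rewrite /kc; lra.
set c : R := 2 * r ^+ 2 * (1 + kc) + (2 + kc).
have c0 : 0 < c by rewrite ltr_wpDl //; [rewrite !mulr_ge0 ?sqr_ge0 //; lra|lra].
(* The minimum of the bounds that [exceptional_null] requires. Like [gam], it is the same for all
   eigenbases, so one net serves every possible limit. *)
pose eta : R := Num.min (Num.min 1 (1 / 2 / kc)) (Num.min (gam / 8) (gam / 4 / c)).
have eta0 : 0 < eta by rewrite !lt_min ltr01 !divr_gt0 //; lra.
have eta1 : eta <= 1 by rewrite !ge_min lexx.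
have etakc : eta * kc <= 1 / 2 by rewrite -ler_pdivlMr ?ge_min ?lexx ?orbT //; lra.
have etag : eta <= gam / 8 by rewrite !ge_min lexx !orbT.
have etac : eta * c <= gam / 4 by rewrite -ler_pdivlMr // !ge_min lexx !orbT.
have {c0} etar : 2 * r ^+ 2 * eta * (1 + kc) + eta * (2 + kc) <= gam / 4.
  by move: etac; rewrite /c; lra.
have ie0 : 0 < 1 / eta by rewrite divr_gt0.
pose C1 : R := 2 * r * (p%:R * (r * n%:R)) + 1.
have C10 : 0 < C1 by rewrite ltr_wpDl ?ltr01 // !mulr_ge0.
pose C2 : R := n%:R * n%:R * (1 + 1 / eta).
have C20 : 0 < C2 by rewrite !mulr_gt0 //; lra.
(* Passing to the net basis may cost eta / 2 in the lag bound and half of the P component. *)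
pose del : R := Num.min (eta / 2 / C1) (1 / 2 / C2).
have del0 : 0 < del by rewrite lt_min !divr_gt0.
have del1 : del * C1 <= eta / 2 by rewrite -ler_pdivlMr // ge_min lexx.
have del2 : del * C2 <= 1 / 2 by rewrite -ler_pdivlMr // ge_min lexx orbT.
have [F [hF netF]] := @countable_net R n n [set V | ordered_eigenbasis A lam V] del
  (ex_intro _ U hU) del0.
have d0 : (0 < n * p)%N by rewrite muln_gt0 p0 (leq_trans p0 hpn).
exists (\bigcup_M \bigcup_T
  [set X | col_box A X /\ exceptional hpn A lam alpha (F M) eta i X^[T]]); split.
  apply: cube_null_count_bigcup => // M; apply: cube_null_bigcup => // T.
  apply: cube_null_iterate => //.
  exact: (exceptional_null symA p_neg alpha_gt0 alpha_r (hF M) gam0).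
move=> X bX nZ [V [hV trV]].
have bXt t := box_iterate rho0 alpha_gt0 alpha_r t bX.
have [M hM] := netF V hV; set V' := F M in hM.
(* Above the cone |x| <= (1 + 1/eta) a for the P component a in the net basis; the limiting basis
   keeps at least a / 2, hence the factor 2. *)
pose Om : R := 2 * (1 + 1 / eta).
have Om1 : 1 <= Om by rewrite /Om; lra.
pose e0 : R := Num.min (eta / 2) (gam / 8 / (1 + Om)).
have e00 : 0 < e0 by rewrite lt_min !divr_gt0 //; lra.
have [|T hT] := expdec_small (e := e0 / (2 * r + 1)) (tracks_lag trV).
  by rewrite divr_gt0 // ltr_wpDl // mulr_ge0.
have lagT t : (T <= t)%N -> 2 * r * lag V X^[t] i <= e0.
  move=> /hT; rewrite ger0_norm ?lag_ge0 //; rewrite ler_pdivlMr; last first.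
    by rewrite ltr_wpDl // mulr_ge0.
  by have := lag_ge0 hpn lam V X^[t] i; lra.
have [bad|] := pselect (forall t, (T <= t)%N ->
    enorm (P i (V'^T *m col i X^[t])) <= eta * enorm (Q i (V'^T *m col i X^[t]))).
  case: nZ; exists M => //; exists T => //; split=> //; split=> // t.
  rewrite iterateD; split; last by apply: bad; exact: leq_addr.
  have h1 := lag_close X^[T + t] i hV hM (ltW del0).
  have h2 := lagT _ (leq_addr t T).
  have h3 : e0 <= eta / 2 by rewrite ge_min lexx.
  have h4 : 2 * r * lag V' X^[T + t] i <=
      2 * r * (lag V X^[T + t] i + p%:R * (r * (n%:R * del))).
    by apply: ler_wpM2l => //; rewrite mulr_ge0.
  by move: del1; rewrite /C1; lra.
move=> /existsNP[t0 /not_implyP[Tt0 /negP]]; rewrite -ltNge.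
set x := col i X^[t0]; set a := enorm (P i (V'^T *m x)); set b := enorm (Q i (V'^T *m x)).
move=> ab; have b0 : 0 <= b := enorm_ge0 _.
have a0 : 0 < a by apply: le_lt_trans ab; rewrite mulr_ge0 // ltW.
have xab : enorm x <= (1 + 1 / eta) * a.
  rewrite -(eigenbasis_enorm_tr x (hF M)) -/V'.
  have := enorm_le_mask (level lam (w i)) (V'^T *m x); rewrite -/a -/b.
  have : b <= 1 / eta * a by rewrite mulrAC mul1r ler_pdivlMr // mulrC ltW.
  lra.
have Plo : a / 2 <= enorm (P i (V^T *m x)).
  have h1 := eigenbasis_close x hM.
  have h2 := enormB_ge (P i (V'^T *m x)) (P i (V'^T *m x - V^T *m x)).
  have h3 := enorm_mask_le (level lam (w i)) (V'^T *m x - V^T *m x).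
  rewrite -/a in h2; rewrite (enorm_subC (V'^T *m x)) in h3.
  have h4 : n%:R * (n%:R * del) * enorm x <= n%:R * (n%:R * del) * ((1 + 1 / eta) * a).
    by apply: ler_wpM2l => //; rewrite !mulr_ge0 // ltW.
  have h5 : del * C2 * a <= 1 / 2 * a by rewrite ler_pM2r.
  have -> : P i (V^T *m x) = P i (V'^T *m x) - P i (V'^T *m x - V^T *m x).
    by rewrite !maskE opprB addrC subrK.
  by move: h5; rewrite /C2; lra.
apply: (@tracks_next V X i gam Om t0) => //.
- move=> t t0t; rewrite mulrC -ler_pdivlMr; last by lra.
  by apply: le_trans (lagT t (leq_trans Tt0 t0t)) _; rewrite ge_min lexx orbT.
- by apply: lt_le_trans Plo; rewrite divr_gt0.
rewrite -/x; apply: le_trans (enorm_mask_le _ _) _; rewrite (eigenbasis_enorm_tr _ hV).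
apply: (le_trans xab).
have : (1 + 1 / eta) * (a / 2) <= (1 + 1 / eta) * enorm (P i (V^T *m x)).
  by apply: ler_wpM2l => //; lra.
by rewrite /Om; lra.
Qed.

Lemma all_columns_null U i : ordered_eigenbasis A lam U -> (0 < p)%N -> (i <= p)%N ->
  exists Z : set 'M[R]_(n, p), cube_null Z /\
    forall X, col_box A X -> ~ Z X ->
    exists V, ordered_eigenbasis A lam V /\ tracks V X i.
Proof.
move=> hU p0; have d0 : (0 < n * p)%N by rewrite muln_gt0 p0 (leq_trans p0 hpn).
elim: i => [_|i IH ip]; first by exists set0; split; [exact: cube_null0|move=> X _ _; exists U].
have [Z [Z0 hZ]] := IH (ltnW ip).
have [Z' [Z0' hZ']] := next_column_null (Ordinal ip) hU.
exists (Z `|` Z'); split; first exact: cube_nullU.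
move=> X bX nZ; apply: hZ' => //; first by move=> h; apply: nZ; right.
by apply: hZ => // h; apply: nZ; left.
Qed.

End NextColumn.

Lemma expdec_cvg (R : realType) (u : nat -> R) : expdec u -> u t @[t --> \oo] --> (0 : R).
Proof.
move=> hu; apply/cvgr0Pnorm_le => e e0; have [T hT] := expdec_small hu e0.
by exists T => // t /= Tt; exact: hT.
Qed.

Lemma normF_le_cols (R : realType) n p (M : 'M[R]_(n, p)) :
  normF M <= \sum_j enorm (col j M).
Proof.
pose v : 'cV[R]_p := \col_j enorm (col j M).
have -> : normF M = enorm v.
  rewrite /normF exchange_big /=; congr Num.sqrt; apply: eq_bigr => j _.
  by rewrite mxE enormE; apply: eq_bigr => i _; rewrite !mxE expr2.
apply: le_trans (enorm_le_sum _) _; apply: ler_sum => j _.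
by rewrite mxE ger0_norm ?enorm_ge0.
Qed.

Lemma distF_cvg0 (R : realType) n p (X : nat -> 'M[R]_(n, p)) (S : set 'M[R]_(n, p)) Y :
  S Y -> (forall j, expdec (fun t => enorm (col j (X t) - col j Y))) ->
  distF (X t) S @[t --> \oo] --> (0 : R).
Proof.
move=> SY hX; apply: expdec_cvg.
apply: (expdec_le (M := 1) (expdec_sum (index_enum 'I_p) (P := xpredT) (fun j _ => hX j))).
move=> t; have lb : lbound [set normF (X t - Y') | Y' in S] 0.
  by move=> _ [Y' _ <-]; exact: sqrtr_ge0.
have ne : [set normF (X t - Y') | Y' in S] !=set0 by exists (normF (X t - Y)), Y.
rewrite mul1r !ger0_norm; last 2 first.
- by apply: sumr_ge0 => j _; exact: enorm_ge0.
- exact: lb_le_inf.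
apply: (@le_trans _ _ (normF (X t - Y))).
  by apply: ge_inf; [exists 0|exists Y].
apply: le_trans (normF_le_cols _) _; apply: ler_sum => j _.
rewrite le_eqVlt; apply/orP; left; apply/eqP; congr enorm.
by apply/matrixP=> k o; rewrite !mxE.
Qed.

Theorem theorem3p5 (R : realType) (n p : nat) (A : 'M[R]_n)
    (lam : 'I_n -> R) (U : 'M[R]_n) (alpha : R)
    (symA : A^T = A)
    (eigA : ordered_eigenbasis A lam U)
    (p_gt0 : (0 < p)%N)
    (p_le_q : (p <= num_neg lam)%N)
    (alpha_gt0 : 0 < alpha)
    (alpha_le : alpha <= 1 / (10 * col_radius (spectral_norm A) p ^+ 2)) :
  exists W : set 'M[R]_(n, p),
    measure_zero W /\
    forall X0 : 'M[R]_(n, p),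
      (forall i : 'I_p, enorm (col i X0) <= col_radius (spectral_norm A) i.+1) ->
      ~ W X0 ->
      distF (iterate A alpha X0 t) (Xstar (num_neg_bound p_le_q) A lam)
        @[t --> \oo] --> (0 : R).
Proof.
set hpn := num_neg_bound p_le_q.
have rho0 := spectral_gt0 hpn p_le_q (Ordinal p_gt0) eigA.
set r := col_radius (spectral_norm A) p.
have r0 : 0 < r ^+ 2.
  by rewrite exprn_gt0 // mulr_gt0 ?exprn_gt0 // sqrtr_gt0 mulr_gt0.
have alpha_r : alpha * r ^+ 2 <= 1 / 10.
  have h : alpha * (10 * r ^+ 2) <= 1.
    by rewrite -ler_pdivlMr //; exact: mulr_gt0.
  lra.
have [W [W0 hW]] := all_columns_null hpn symA p_le_q alpha_gt0 alpha_r eigA p_gt0 (leqnn p).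
exists W; split.
  by apply: cube_null_measure_zero => //; rewrite muln_gt0 p_gt0 (leq_trans p_gt0 hpn).
move=> X0 bX nW; have [V [hV trV]] := hW X0 bX nW.
apply: (@distF_cvg0 _ _ _ _ _ (ideal hpn lam V)) => [|j]; last exact: trV.
exists V => //; exists 1%:M; last by rewrite mulmx1.
split; first exact: scalar_mx_is_diag.
by move=> j; rewrite mxE eqxx; left.
Qed.
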